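(* Let $q\ge 3$, $p\ge q$ be integers, $s\in\mathbb{N}$, and let $Y_s=\{y_i\}_{i=1}^{2s}$ be any collection of points with $y_{2s}<\cdots<y_1<y_{2s}+2\pi=:y_0$. For each sequence $\{\varepsilon_n\}_{n=1}^\infty$ of positive numbers tending to infinity, there is a function $f\in\Delta^{(q)}(Y_s)\cap W^p$ such that $$\limsup_{n\to\infty}\varepsilon_n n^{p-q+2}E_n^{(q)}(f,Y_s)=\infty.$$
   Context: A function $f\in C[a,b]$ is called $q$-monotone ($q\ge 2$) if $f\in C^{q-2}(a,b)$ and $f^{(q-2)}$ is convex on $(a,b)$. For $Y_s$ as in the claim, $\Delta^{(q)}(Y_s)$ denotes the set of continuous $2\pi$-periodic functions $f:\mathbb{R}\to\mathbb{R}$ such that $(-1)^{i-1}f$ is $q$-monotone on $[y_i,y_{i-1}]$ for each $1\le i\le 2s$. For $r\in\mathbb{N}$, $W^r$ denotes the class of $2\pi$-periodic functions $f$ with $f^{(r-1)}$ locally absolutely continuous on $\mathbb{R}$ and $\operatorname{ess\,sup}_{x\in\mathbb{R}}|f^{(r)}(x)|\le 2$. $\mathcal{T}_n$ is the space of real trigonometric polynomials of degree $\le n$. For a continuous $2\pi$-periodic $g$, $\|g\|=\max_{x\in\mathbb{R}}|g(x)|$, and $E_n^{(q)}(g,Y_s):=\inf_{T_n\in\mathcal{T}_n\cap\Delta^{(q)}(Y_s)}\|g-T_n\|$. *)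

(* Defs.v *)
From HB Require Import structures.
From mathcomp Require Import all_boot all_order all_algebra.
From mathcomp Require Import all_classical all_reals all_analysis ess_sup_inf.
Set Implicit Arguments. Unset Strict Implicit. Unset Printing Implicit Defensive.
Import Order.TTheory GRing.Theory Num.Theory.
Import numFieldNormedType.Exports.
Local Open Scope classical_set_scope.
Local Open Scope ring_scope.

Section Defs.
Variable R : realType.

Definition Ck_open (k : nat) (f : R -> R) (a b : R) : Prop :=
  (forall j : nat, (j < k)%N -> forall x, x \in `]a, b[ -> derivable ((derive1n (j) f)) x 1)
  /\ {in `]a, b[, continuous ((derive1n (k) f))}.

Definition convex_on_open (g : R -> R) (a b : R) : Prop :=
  forall x y t, x \in `]a, b[ -> y \in `]a, b[ -> 0 <= t -> t <= 1 ->
    g (t * x + (1 - t) * y) <= t * g x + (1 - t) * g y.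

Definition q_monotone (q : nat) (f : R -> R) (a b : R) : Prop :=
  {within `[a, b], continuous f} /\ Ck_open (q - 2) f a b
  /\ convex_on_open ((derive1n (q - 2) f)) a b.

Definition periodic2pi (f : R -> R) : Prop := forall x, f (x + 2 * pi) = f x.

(* The points y_1,...,y_{2s} are y 1, ..., y (2s); y_0 := y_{2s} + 2 pi. *)
Definition yext (s : nat) (y : nat -> R) (i : nat) : R :=
  if i == 0%N then y (2 * s)%N + 2 * pi else y i.

Definition Delta (q s : nat) (y : nat -> R) (f : R -> R) : Prop :=
  continuous f /\ periodic2pi f /\
  forall i : nat, (1 <= i <= 2 * s)%N ->
    q_monotone q (fun x => (-1) ^+ (i - 1) * f x) (yext s y i) (yext s y (i - 1)%N).

Definition abs_cont_on (g : R -> R) (a b : R) : Prop :=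
  forall e : R, 0 < e -> exists2 d : R, 0 < d &
    forall (m : nat) (u v : nat -> R),
      (forall k, (k < m)%N -> a <= u k /\ u k < v k /\ v k <= b) ->
      (forall k l, (k < l < m)%N -> v k <= u l) ->
      \sum_(k < m) (v k - u k) < d ->
      \sum_(k < m) `|g (v k) - g (u k)| < e.

Definition loc_abs_cont (g : R -> R) : Prop :=
  forall a b : R, a < b -> abs_cont_on g a b.

Definition Wr (r : nat) (f : R -> R) : Prop :=
  periodic2pi f /\
  (forall j : nat, (j < r - 1)%N -> forall x, derivable ((derive1n (j) f)) x 1) /\
  loc_abs_cont ((derive1n (r - 1) f)) /\
  (ess_sup (@lebesgue_measure R) (fun x => (`|(derive1n (r) f) x|)%:E) <= 2%:E)%E.

Definition trig_poly (n : nat) (T : R -> R) : Prop :=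
  exists a b : nat -> R, forall x,
    T x = a 0%N + \sum_(1 <= k < n.+1) (a k * cos (k%:R * x) + b k * sin (k%:R * x)).

Definition supnorm (g : R -> R) : R := sup [set `|g x| | x in setT].

Definition En (q s : nat) (y : nat -> R) (n : nat) (g : R -> R) : R :=
  inf [set supnorm (fun x => g x - T x) | T in [set T | trig_poly n T /\ Delta q s y T]].

End Defs.

(* Main.v *)
Require Import Defs.
From HB Require Import structures.
From mathcomp Require Import all_boot all_order all_algebra.
From mathcomp Require Import all_classical all_reals all_analysis ess_sup_inf.
From mathcomp Require Import ring lra.
Import Order.TTheory GRing.Theory Num.Theory.
Import numFieldNormedType.Exports.
Local Open Scope classical_set_scope.
Local Open Scope ring_scope.
Set Implicit Arguments.
Unset Strict Implicit.
Unset Printing Implicit Defensive.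

(** Write [a = y 1], [D = p - q], and let [T] be a trigonometric polynomial of
degree [n] in [Delta q s y]. Its [q]-th derivative [tau] changes sign at [a], so
[(x - a) * tau x = |x - a| * |tau x|] near [a]. The function
[cos ((2 n + 1) (x - a))], localized by the factor [((1 + cos (x - a)) / 2)^n], is
orthogonal to [tau] and equals [1] at [a]; subtracting it from the constant [1] shows
that the net mass of [tau] near [a] is at most [C n] times its first absolute moment:
[tau] cannot concentrate within [o(1/n)] of its sign change. If [f^(q)] near [a] is a
bump of width [h = c / n] immediately to the right of [a], of mass [h^(D+1)] (the
largest order compatible with a bounded [f^(p)]), then its moment is only [h^(D+2)].
Both functionals are integrals over a fixed interval against polynomials vanishing to
order [q] at its ends, hence continuous for the uniform norm of [f - T] by integrating
by parts [q] times; so [|f - T| >= c' n^-(D+2)].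

The function [f] carries infinitely many such bumps accumulating at [a], the [k]-th one
damped by [2^-k] and located so close to [a] that the growth of [eps] beats all
constants depending on the earlier bumps. A compensating negative bump in [(y 2, y 1)],
away from [a], restores the mean value zero needed for periodicity. *)

(** * Antiderivatives and integrals *)

Section Antiderivative.
Variable R : realType.
Implicit Types (f g u v F G : R -> R) (a b c x : R).

Definition antiderivative F g := forall x, is_derive x 1 F (g x).

Lemma antiderivative_continuous F g : antiderivative F g -> continuous F.
Proof.
move=> Fg x; have := Fg x => ?.
exact/differentiable_continuous/derivable1_diffP.
Qed.

Lemma antiderivative_ext F1 g1 F g : F1 =1 F -> g1 =1 g ->
  antiderivative F1 g1 -> antiderivative F g.
Proof. by move=> /funext -> /funext ->. Qed.

Lemma antiderivative_cst c : antiderivative (fun=> c) (fun=> 0).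
Proof. by move=> x; exact: is_derive_cst. Qed.

Lemma antiderivativeD F G f g : antiderivative F f -> antiderivative G g ->
  antiderivative (fun x => F x + G x) (fun x => f x + g x).
Proof. by move=> Ff Gg x; have := Ff x; have := Gg x => ? ?; exact: is_deriveD. Qed.

Lemma antiderivativeZ k F f : antiderivative F f ->
  antiderivative (fun x => k * F x) (fun x => k * f x).
Proof. by move=> Ff x; have := Ff x => ?; exact: is_deriveZ. Qed.

Lemma antiderivativeB F G f g : antiderivative F f -> antiderivative G g ->
  antiderivative (fun x => F x - G x) (fun x => f x - g x).
Proof. by move=> Ff Gg x; have := Ff x; have := Gg x => ? ?; exact: is_deriveB. Qed.

Lemma antiderivativeM F G f g : antiderivative F f -> antiderivative G g ->
  antiderivative (fun x => F x * G x) (fun x => f x * G x + F x * g x).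
Proof.
move=> Ff Gg x; have := Ff x; have := Gg x => ? ?.
apply: (is_derive_eq (is_deriveM _ _)); rewrite /GRing.scale/=; ring.
Qed.

Lemma antiderivative_sum n (F f : 'I_n -> R -> R) :
  (forall i, antiderivative (F i) (f i)) ->
  antiderivative (fun x => \sum_(i < n) F i x) (fun x => \sum_(i < n) f i x).
Proof.
move=> H x; have H' i := H i x.
have := is_derive_sum (fun i => H' i).
by rewrite fct_sumE.
Qed.

Lemma antiderivative_affine F f c d : antiderivative F f ->
  antiderivative (fun x => F (c * x + d)) (fun x => c * f (c * x + d)).
Proof.
move=> Ff x.
have h : is_derive x 1 (fun x => c * x + d) c.
  have := @antiderivativeD _ _ _ _ (antiderivativeZ c (fun x => is_derive_id x 1)) (antiderivative_cst d) x.
  by rewrite mulr1 addr0.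
have := Ff (c * x + d) => H.
by have := @is_derive1_comp R F (fun x => c * x + d) x _ _ H h; rewrite mulrC.
Qed.

Lemma antiderivative0_cst F a b : antiderivative F (fun=> 0) -> F a = F b.
Proof. by move=> F0; exact: is_derive_0_is_cst. Qed.

Lemma antiderivative_mvt F f a b : antiderivative F f -> a < b ->
  exists2 c, a < c < b & F b - F a = f c * (b - a).
Proof.
move=> Ff ab; have [|c] := @MVT R F f a b ab (fun x _ => Ff x).
  exact/continuous_subspaceT/antiderivative_continuous/Ff.
by rewrite in_itv/= => ? ?; exists c.
Qed.

Lemma antiderivative_le F f a b : antiderivative F f -> a <= b ->
  (forall x, a <= x <= b -> 0 <= f x) -> F a <= F b.
Proof.
move=> Ff; rewrite le_eqVlt => /predU1P[->//|ab] f0.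
have [c /andP[ac cb] FE] := antiderivative_mvt Ff ab.
by rewrite -subr_ge0 FE mulr_ge0 ?subr_ge0 ?(ltW ab)// f0// !ltW.
Qed.

Lemma antiderivative_half_line g c : continuous g ->
  exists F, forall x, c < x -> is_derive x 1 F (g x).
Proof.
move=> cg; exists (fun x => (\int[lebesgue_measure]_(t in `[c, x]) g t)%R) => x cx.
have [||dF FE] := @continuous_FTC1_closed R g c x (x + 1) _ _ cx (cg x).
- by rewrite ltrDl.
- apply: continuous_compact_integrable; first exact: segment_compact.
  exact: continuous_subspaceT.
- by apply: DeriveDef; [exact: dF | rewrite -derive1E; exact: FE].
Qed.

(** Half-line antiderivatives starting at [- n%:R] are glued: once normalized to vanish at 0, any
    two agree on the common part of their half-lines. *)
Lemma antiderivative_exists g : continuous g -> exists F, antiderivative F g.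
Proof.
move=> cg.
have /choice[A HA] : forall n : nat, exists F, forall x, - (n%:R : R) < x -> is_derive x 1 F (g x).
  by move=> n; exact: antiderivative_half_line.
have indep m n x : (0 < m)%N -> (0 < n)%N -> - (m%:R : R) < x -> - (n%:R : R) < x ->
    A m x - A m 0 = A n x - A n 0.
  move=> m0 n0 mx nx.
  have der z : - (m%:R : R) < z -> - (n%:R : R) < z -> is_derive z 1 (A m \- A n) 0.
    move=> mz nz; have := HA m z mz; have := HA n z nz => ? ?.
    by apply: (is_derive_eq (is_deriveB _ _)); rewrite subrr.
  have m0' : 0 < m%:R :> R by rewrite ltr0n.
  have n0' : 0 < n%:R :> R by rewrite ltr0n.
  have cst z w : - (m%:R : R) < z -> - (n%:R : R) < z -> z < w ->
      (A m \- A n) w = (A m \- A n) z.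
    move=> mz nz zw.
    have [||c _ /eqP] := @MVT R (A m \- A n) (fun=> 0) z w zw.
    - by move=> t; rewrite in_itv/= => /andP[zt _]; apply: der; exact: lt_trans zt.
    - apply: derivable_within_continuous => t; rewrite in_itv/= => /andP[zt _].
      by have [] : is_derive t 1 (A m \- A n) 0 by apply: der; exact: lt_le_trans zt.
    - by rewrite mul0r subr_eq0 => /eqP.
  have [x0|x0|->] := ltgtP x 0; last by rewrite !subrr.
  - by have /= := cst x 0 mx nx x0; lra.
  - have /= := cst 0 x; rewrite !oppr_lt0 => /(_ m0' n0' x0); lra.
(* The margin 1 makes the half-line chosen for [x] contain all points within distance 1 of [x], so
   near [x] the glued function is a single [A (N x)] up to a constant. *)
have [N HN] : exists N : R -> nat, forall x, (0 < N x)%N /\ `|x| + 1 < (N x)%:R.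
  have /choice[N HN] : forall x, exists n : nat, (0 < n)%N /\ `|x| + 1 < n%:R.
    move=> x; exists (Num.Def.truncn (`|x| + 1)).+1; split => //.
    by rewrite truncnS_gt.
  by exists N.
exists (fun x => A (N x) x - A (N x) 0) => x.
have [Nx0 Nx] := HN x.
apply: (@near_eq_is_derive _ _ _ (fun z => A (N x) z - A (N x) 0)).
  near=> z.
  have zx : `|x - z| < 1 by near: z; apply: cvgr_dist_lt.
  have [Nz0 Nz] := HN z.
  apply: indep => //.
    have := ler_normB x (x - z); rewrite opprB addrCA subrr addr0 => h.
    have := ler_norm (-z); rewrite normrN; lra.
  have := ler_norm (-z); rewrite normrN; lra.
have Nxx : - (N x)%:R < x.
  by have := ler_norm (-x); rewrite normrN; lra.
have := @is_deriveB R _ _ (A (N x)) (cst (A (N x) 0)) x 1 _ 0 (HA (N x) x Nxx) (is_derive_cst _ _ _).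
by rewrite subr0.
Unshelve. all: by end_near. Qed.

End Antiderivative.

(** * Integrals as increments of a primitive *)

Section Integral.
Variable R : realType.
Implicit Types (f g u v F G : R -> R) (a b c x : R).

(* Defined through an arbitrary antiderivative, so no measurability or
   integrability side conditions arise; junk when there is none. *)
Definition prim f : R -> R := xget (fun=> 0) [set F | antiderivative F f].

Definition itg a b f : R := prim f b - prim f a.

Lemma prim_antiderivative_ex F f : antiderivative F f -> antiderivative (prim f) f.
Proof.
by move=> Ff; have := @xgetPex _ (fun=> 0) [set G : R -> R | antiderivative G f] (ex_intro _ F Ff).
Qed.

Lemma prim_antiderivative f : continuous f -> antiderivative (prim f) f.
Proof. by move=> /antiderivative_exists[F]; exact: prim_antiderivative_ex. Qed.

Lemma itgE F f a b : antiderivative F f -> itg a b f = F b - F a.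
Proof.
move=> Ff; have Pf := prim_antiderivative_ex Ff.
have /(antiderivative0_cst a b) /= : antiderivative (fun x => prim f x - F x) (fun=> 0).
  by apply: antiderivative_ext (antiderivativeB Pf Ff) => x //; rewrite subrr.
rewrite /itg; lra.
Qed.

Lemma eq_itg f g a b : f =1 g -> itg a b f = itg a b g.
Proof. by move=> /funext ->. Qed.

Lemma itgD f g a b : continuous f -> continuous g ->
  itg a b (fun x => f x + g x) = itg a b f + itg a b g.
Proof.
move=> cf cg.
rewrite (itgE _ _ (antiderivativeD (prim_antiderivative cf) (prim_antiderivative cg))).
rewrite /itg; ring.
Qed.

Lemma itgZ k f a b : continuous f -> itg a b (fun x => k * f x) = k * itg a b f.
Proof.
move=> cf; rewrite (itgE _ _ (antiderivativeZ k (prim_antiderivative cf))).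
by rewrite /itg mulrBr.
Qed.

Lemma itgB f g a b : continuous f -> continuous g ->
  itg a b (fun x => f x - g x) = itg a b f - itg a b g.
Proof.
move=> cf cg.
rewrite (itgE _ _ (antiderivativeB (prim_antiderivative cf) (prim_antiderivative cg))).
rewrite /itg; ring.
Qed.

Lemma itg_cst k a b : itg a b (fun=> k) = k * (b - a).
Proof.
have H : antiderivative (fun x => k * x + 0) (fun=> k).
  move=> x; have := @antiderivative_affine R id (fun=> 1) k 0 (fun x => is_derive_id x 1) x.
  by rewrite mulr1.
rewrite (itgE _ _ H); ring.
Qed.

Lemma itg_cat b f a c : itg a c f = itg a b f + itg b c f.
Proof. rewrite /itg; ring. Qed.

Lemma itg_sum n (f : 'I_n -> R -> R) a b : (forall i, continuous (f i)) ->
  itg a b (fun x => \sum_(i < n) f i x) = \sum_(i < n) itg a b (f i).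
Proof.
move=> cf.
rewrite (itgE _ _ (antiderivative_sum (fun i => prim_antiderivative (cf i)))).
by rewrite -sumrB.
Qed.

Lemma le_itg f g a b : a <= b -> continuous f -> continuous g ->
  (forall x, a <= x <= b -> f x <= g x) -> itg a b f <= itg a b g.
Proof.
move=> ab cf cg fg; rewrite -subr_ge0 -itgB// subr_ge0.
apply: (@antiderivative_le _ _ (fun x => g x - f x)) => //.
  apply: prim_antiderivative => x; apply: cvgB; [exact: cg|exact: cf].
by move=> x xab; rewrite subr_ge0 fg.
Qed.

Lemma itg_eq_in f g a b : a <= b -> continuous f -> continuous g ->
  (forall x, a <= x <= b -> f x = g x) -> itg a b f = itg a b g.
Proof.
move=> ab cf cg fg; apply/eqP; rewrite eq_le.
by apply/andP; split; apply: le_itg => // x xab; rewrite fg.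
Qed.

Lemma itg_ge0 f a b : a <= b -> continuous f ->
  (forall x, a <= x <= b -> 0 <= f x) -> 0 <= itg a b f.
Proof.
move=> ab cf f0; rewrite -(mul0r (b - a)) -itg_cst; apply: le_itg => //.
by move=> x; exact: cvg_cst.
Qed.

Lemma norm_itg_le f k a b : a <= b -> continuous f ->
  (forall x, a <= x <= b -> `|f x| <= k) -> `|itg a b f| <= k * (b - a).
Proof.
move=> ab cf fk; have cc (c : R) : continuous (fun _ : R => c) by move=> x; exact: cvg_cst.
rewrite ler_norml -mulNr -!itg_cst; apply/andP; split; apply: le_itg => // x /fk;
  by rewrite ler_norml => /andP[].
Qed.

Lemma itg_affine f a b c d : c != 0 -> continuous f ->
  itg a b (fun x => f (c * x + d)) = c^-1 * itg (c * a + d) (c * b + d) f.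
Proof.
move=> c0 cf; have := antiderivativeZ c^-1 (antiderivative_affine c d (prim_antiderivative cf)).
move=> /(@antiderivative_ext _ _ _ _ (fun x => f (c * x + d)) (fun=> erefl)) H.
rewrite (itgE _ _ (H _)) ?mulrBr// => x; by rewrite mulrA mulVf ?mul1r.
Qed.

Lemma itg_by_parts u u' v v' a b :
  antiderivative u u' -> antiderivative v v' -> continuous u' -> continuous v' ->
  itg a b (fun x => u' x * v x) = u b * v b - u a * v a - itg a b (fun x => u x * v' x).
Proof.
move=> uu vv cu' cv'.
have cu := antiderivative_continuous uu; have cv := antiderivative_continuous vv.
rewrite -(itgE a b (antiderivativeM uu vv)) itgD; first by rewrite addrK.
- by move=> x; apply: cvgM; [exact: cu'|exact: cv].
- by move=> x; apply: cvgM; [exact: cu|exact: cv'].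
Qed.

End Integral.

(** * Towers of derivatives and membership in [Delta] and [Wr] *)

Section Tower.
Variable R : realType.
Implicit Types (f g v w : R -> R) (U V : nat -> R -> R) (a b c x : R) (k i : nat).

(* [U i] stands for the [i]-th derivative of [U 0]. *)
Definition tower k U :=
  (forall i, (i < k)%N -> antiderivative (U i) (U i.+1)) /\ continuous (U k).

Lemma tower_continuous k U i : tower k U -> (i <= k)%N -> continuous (U i).
Proof.
move=> [tU cU]; rewrite leq_eqVlt => /predU1P[->//|ik].
exact: antiderivative_continuous (tU i ik).
Qed.

Lemma tower_le k l U : (l <= k)%N -> tower k U -> tower l U.
Proof.
move=> lk tU; split; last exact: tower_continuous tU lk.
by move=> i il; apply: tU.1; exact: leq_trans lk.
Qed.

Lemma tower_derive1n k U i : tower k U -> (i <= k)%N -> derive1n i (U 0%N) = U i.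
Proof.
move=> [tU _]; elim: i => [//|i IH] ik; rewrite derive1nS IH ?(ltnW ik)//.
by apply/funext => x; rewrite derive1E; have [_ ->] := tU i ik x.
Qed.

Lemma tower_derivable k U i x : tower k U -> (i < k)%N -> derivable (derive1n i (U 0%N)) x 1.
Proof.
move=> tU ik; rewrite (tower_derive1n tU (ltnW ik)).
by have [] := tU.1 i ik x.
Qed.

Lemma towerZ k U c : tower k U -> tower k (fun i x => c * U i x).
Proof.
move=> [tU cU]; split => [i ik|x]; first exact/antiderivativeZ/tU.
by apply: cvgM; [exact: cvg_cst | exact: cU].
Qed.

Lemma towerB k U V : tower k U -> tower k V -> tower k (fun i x => U i x - V i x).
Proof.
move=> [tU cU] [tV cV]; split => [i ik|x]; first exact: antiderivativeB (tU i ik) (tV i ik).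
by apply: cvgB; [exact: cU | exact: cV].
Qed.

Lemma tower_cst0 k : tower k (fun _ _ => 0).
Proof. by split => [i _|x]; [exact: antiderivative_cst | exact: cvg_cst]. Qed.

Lemma tower_affine k U c d : tower k U -> tower k (fun i x => c ^+ i * U i (c * x + d)).
Proof.
move=> [tU cU]; split => [i ik|x].
  have := antiderivativeZ (c ^+ i) (antiderivative_affine c d (tU i ik)).
  by apply: antiderivative_ext => // x; rewrite mulrA exprSr.
apply: cvgM; first exact: cvg_cst.
apply: continuous_comp; last exact: cU.
by apply: cvgD; [apply: cvgM; [exact: cvg_cst|exact: cvg_id]|exact: cvg_cst].
Qed.

(** The slopes of [v] on the two sides of an intermediate point are values of [v'], which is
    nondecreasing. *)
Lemma convex_on_open_of_second_derivative v v' w a b :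
  antiderivative v v' -> antiderivative v' w ->
  (forall x, a < x < b -> 0 <= w x) -> convex_on_open v a b.
Proof.
move=> vv' vw w0.
have H x y t : a < x -> y < b -> x < y -> 0 < t < 1 ->
    v (t * x + (1 - t) * y) <= t * v x + (1 - t) * v y.
  move=> ax yb xy /andP[t0 t1]; set z := _ + _.
  have zx : z - x = (1 - t) * (y - x) by rewrite /z; ring.
  have yz : y - z = t * (y - x) by rewrite /z; ring.
  have xz : x < z by rewrite -subr_gt0 zx mulr_gt0// subr_gt0.
  have zy : z < y by rewrite -subr_gt0 yz mulr_gt0// subr_gt0.
  have [c1 /andP[xc1 c1z] E1] := antiderivative_mvt vv' xz.
  have [c2 /andP[zc2 c2y] E2] := antiderivative_mvt vv' zy.
  have le12 : v' c1 <= v' c2.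
    apply: (antiderivative_le vw); first by rewrite ltW// (lt_trans c1z).
    by move=> u /andP[u1 u2]; apply: w0; rewrite (lt_le_trans _ u1) ?(lt_trans ax)//= (le_lt_trans u2)// (lt_trans c2y).
  have e1 : v z = v x + v' c1 * ((1 - t) * (y - x)) by rewrite -zx -E1; ring.
  have e2 : v y = v z + v' c2 * (t * (y - x)) by rewrite -yz -E2; ring.
  have : 0 <= t * (1 - t) * (y - x) * (v' c2 - v' c1).
    by rewrite mulr_ge0 ?subr_ge0// mulr_ge0 ?mulr_ge0// ?subr_ge0 ltW.
  rewrite e2 e1; lra.
move=> x y t; rewrite !in_itv/= => /andP[ax xb] /andP[ay yb].
rewrite le_eqVlt => /predU1P[<-|t0]; first by rewrite !mul0r !add0r subr0 !mul1r.
rewrite le_eqVlt => /predU1P[->|t1]; first by rewrite subrr !mul0r !addr0 !mul1r.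
have [xy|yx|->] := ltgtP x y.
- by apply: H => //; rewrite t0 t1.
- have := H y x (1 - t) ay xb yx; rewrite subKr [_ * y + _]addrC [_ * v y + _]addrC.
  by apply; rewrite subr_gt0 t1/= gtrBl.
- by rewrite -!mulrDl addrC subrK !mul1r.
Qed.

(** If [w x < 0], then by continuity [w] is negative around [x], so [v'] strictly decreases there,
    against midpoint convexity on a short interval centred at [x]. *)
Lemma second_derivative_ge0_of_convex v v' w a b x :
  antiderivative v v' -> antiderivative v' w -> continuous w ->
  convex_on_open v a b -> a < x < b -> 0 <= w x.
Proof.
move=> vv' vw cw cvx /andP[ax xb]; rewrite leNgt; apply/negP => wx0.
have : \forall z \near x, w z < 0.
  exact: (cvgr_lt _ (cw x)).
move=> /nbhs_ballP[e /= e0 He].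
have [d [d0 dx dy de]] : exists d, [/\ 0 < d, a < x - d, x + d < b & d < e].
  exists (Num.min (Num.min ((x - a) / 2) ((b - x) / 2)) (e / 2)).
  have := @divr_gt0 R (x - a) 2; have := @divr_gt0 R (b - x) 2; have := @divr_gt0 R e 2.
  rewrite !subr_gt0 => /(_ e0 (ltr0n _ 2)) ? /(_ xb (ltr0n _ 2)) ? /(_ ax (ltr0n _ 2)) ?.
  split; first by rewrite !lt_min; apply/andP; split => //; apply/andP.
  - by rewrite ltrBrDr -ltrBrDl !gt_min; apply/orP; left; apply/orP; left; lra.
  - by rewrite -ltrBrDl !gt_min; apply/orP; left; apply/orP; right; lra.
  - by rewrite !gt_min; apply/orP; right; lra.
have [c1 /andP[? ?] E1] := antiderivative_mvt vv' (ltac:(lra) : x - d < x).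
have [c2 /andP[? ?] E2] := antiderivative_mvt vv' (ltac:(lra) : x < x + d).
have [c3 /andP[? ?] E3] := antiderivative_mvt vw (ltac:(lra) : c1 < c2).
have w3 : w c3 < 0 by apply: He; rewrite /ball/= ltr_norml; lra.
have := cvx (x - d) (x + d) 2^-1; rewrite !in_itv/= => /(_ _ _ _ _).
have -> : 2^-1 * (x - d) + (1 - 2^-1) * (x + d) = x by field.
move=> /(_ (ltac:(lra)) (ltac:(lra)) (ltac:(lra)) (ltac:(lra))) h.
have : (v' c2 - v' c1) * d >= 0 by lra.
rewrite pmulr_lge0// E3 leNgt => /negP; apply.
by rewrite nmulr_rlt0// subr_gt0; lra.
Qed.

(** For a function with [q] continuous derivatives, shape on an arc is the sign of the [q]-th
    derivative, the second derivative of the function required to be convex. [Delta_tower] is the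
    converse direction. *)
Lemma tower_Delta q s (y : nat -> R) U : (2 <= q)%N -> tower q U -> periodic2pi (U 0%N) ->
  (forall i x, (1 <= i <= 2 * s)%N -> yext s y i < x < yext s y (i - 1)%N ->
     0 <= (-1) ^+ (i - 1) * U q x) ->
  Delta q s y (U 0%N).
Proof.
move=> q2 tU pU sgn; split; first exact: tower_continuous tU _.
split=> // i i1.
have tV := towerZ ((-1) ^+ (i - 1)) tU.
have q1 : (q - 2 < q)%N by rewrite ltn_subrL (leq_trans _ q2).
have q3 : ((q - 2).+1 < q)%N by rewrite -subSn// subSS ltn_subrL (leq_trans _ q2).
split; first by apply: continuous_subspaceT; exact: (tower_continuous tV).
split; [split|].
- by move=> j jq x _; apply: (tower_derivable tV); exact: ltn_trans q1.
- by move=> x _; rewrite (tower_derive1n tV (ltnW q1)); apply: (tower_continuous tV); exact: ltnW.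
- rewrite (tower_derive1n tV (ltnW q1)).
  apply: (convex_on_open_of_second_derivative (tV.1 _ q1) (tV.1 _ q3)) => x.
  have -> : (q - 2).+2 = q by case: q q2 {tU sgn tV q1 q3} => [|[|q]] // _; rewrite !subSS subn0.
  exact: sgn.
Qed.

Lemma Delta_tower q s (y : nat -> R) U i x : (2 <= q)%N -> tower q U -> Delta q s y (U 0%N) ->
  (1 <= i <= 2 * s)%N -> yext s y i < x < yext s y (i - 1)%N ->
  0 <= (-1) ^+ (i - 1) * U q x.
Proof.
move=> q2 tU [_ [_ /(_ i)]] H i1 xi; have [_ [_ ]] := H i1.
have tV := towerZ ((-1) ^+ (i - 1)) tU.
have q1 : (q - 2 < q)%N by rewrite ltn_subrL (leq_trans _ q2).
have q3 : ((q - 2).+1 < q)%N by rewrite -subSn// subSS ltn_subrL (leq_trans _ q2).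
rewrite (tower_derive1n tV (ltnW q1)) => cvx.
have := second_derivative_ge0_of_convex (tV.1 _ q1) (tV.1 _ q3).
have -> : (q - 2).+2 = q by case: q q2 {tU tV q1 q3 H cvx} => [|[|q]] // _; rewrite !subSS subn0.
by move=> /(_ _ _ _ tV.2 cvx xi).
Qed.

Lemma tower_Wr p U : (0 < p)%N -> tower p U -> periodic2pi (U 0%N) ->
  (forall x, `|U p x| <= 2) -> Wr p (U 0%N).
Proof.
move=> p0 tU pU U2; split => //; split.
  by move=> j jp x; apply: (tower_derivable tU); rewrite (leq_trans jp)// leq_subr.
have p1 : (p - 1 < p)%N by rewrite ltn_subrL p0.
split; last first.
  by apply/ess_supP => //; apply: nearW => x; rewrite lee_fin (tower_derive1n tU).
rewrite (tower_derive1n tU (ltnW p1)) => a b _ e e0.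
(* The bound 2 on the last derivative makes the one before it 2-Lipschitz. *)
exists (e / 2); first by rewrite divr_gt0.
move=> m u v uv _; rewrite ltr_pdivlMr// => /le_lt_trans; apply; rewrite mulr_suml.
apply: ler_sum => k _; have [_ [uvk _]] := uv k (ltn_ord k).
have [c _ ->] := antiderivative_mvt (tU.1 _ p1) uvk.
have -> : (p - 1).+1 = p by rewrite -subSn// subSS subn0.
rewrite normrM mulrC ler_pM// gtr0_norm// subr_gt0//.
Qed.

End Tower.

(** * Trigonometric polynomials and test functions *)

Section Trig.
Variable R : realType.
Implicit Types (f g T : R -> R) (a b : nat -> R) (c x t u : R) (i j k l m n : nat).

Lemma continuous_add f g : continuous f -> continuous g -> continuous (fun x => f x + g x).
Proof. by move=> cf cg x; apply: cvgD; [exact: cf|exact: cg]. Qed.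

Lemma continuous_sub f g : continuous f -> continuous g -> continuous (fun x => f x - g x).
Proof. by move=> cf cg x; apply: cvgB; [exact: cf|exact: cg]. Qed.

Lemma continuous_mul f g : continuous f -> continuous g -> continuous (fun x => f x * g x).
Proof. by move=> cf cg x; apply: cvgM; [exact: cf|exact: cg]. Qed.

Lemma continuous_scale c f : continuous f -> continuous (fun x => c * f x).
Proof. by move=> cf; apply: continuous_mul => // x; exact: cvg_cst. Qed.

Lemma antiderivative_cos c t :
  antiderivative (fun x => cos (c * x + t)) (fun x => c * cos (c * x + t + pi / 2)).
Proof.
have H := antiderivative_affine c t (@is_derive_cos R).
by apply: antiderivative_ext H => // x; rewrite cosDpihalf.
Qed.

Lemma antiderivative_sin c t :
  antiderivative (fun x => sin (c * x + t)) (fun x => c * sin (c * x + t + pi / 2)).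
Proof.
have H := antiderivative_affine c t (@is_derive_sin R).
by apply: antiderivative_ext H => // x; rewrite sinDpihalf.
Qed.

Lemma continuous_cos_affine c t : continuous (fun x => cos (c * x + t)).
Proof. exact: antiderivative_continuous (@antiderivative_cos c t). Qed.

Lemma sinD2pin x k : sin (x + k%:R * (2 * pi)) = sin x.
Proof. by rewrite -(periodicn (@sinD2pi R) k x) mulr_natl mulr_natl. Qed.

Lemma cosMcos x u : cos x * cos u = 2^-1 * (cos (x - u) + cos (x + u)).
Proof. rewrite cosB cosD; by field. Qed.

Lemma itg_cos0 k t u : (0 < k)%N ->
  itg u (u + 2 * pi) (fun x => cos (k%:R * x + t)) = 0.
Proof.
move=> k0; have k0' : (k%:R : R) != 0 by rewrite pnatr_eq0 -lt0n.
have H : antiderivative (fun x => k%:R^-1 * sin (k%:R * x + t)) (fun x => cos (k%:R * x + t)).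
  apply: antiderivative_ext (antiderivativeZ k%:R^-1 (antiderivative_sin k%:R t)) => // x.
  by rewrite sinDpihalf mulrA mulVf// mul1r.
rewrite (itgE _ _ H) mulrDr -addrA [_ * (2 * pi) + t]addrC addrA sinD2pin subrr.
by [].
Qed.

Lemma itg_cosMcos_neq j k s t u : j != k ->
  itg u (u + 2 * pi) (fun x => cos (j%:R * x + s) * cos (k%:R * x + t)) = 0.
Proof.
wlog jk : j k s t / (j < k)%N.
  move=> H jk; have [jk'|jk'] := ltnP j k; first exact: H.
  rewrite -[RHS](H k j t s) 1?eq_sym// ?ltn_neqAle 1?eq_sym ?jk//.
  by apply: eq_itg => x; rewrite mulrC.
move=> _.
rewrite (@eq_itg _ _ (fun x => 2^-1 * (cos ((k - j)%:R * x + (t - s)) + cos ((k + j)%:R * x + (t + s))))).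
  rewrite itgZ; last by apply: continuous_add; exact: continuous_cos_affine.
  rewrite itgD; [|exact: continuous_cos_affine..].
  by rewrite !itg_cos0 ?addr0 ?mulr0// ?subn_gt0// ltn_addr// (leq_ltn_trans _ jk).
move=> x; rewrite mulrC cosMcos natrB ?(ltnW jk)// natrD.
by congr (_ * (cos _ + cos _)); ring.
Qed.

Lemma itg_cosMcos_eq k s t u : (0 < k)%N ->
  itg u (u + 2 * pi) (fun x => cos (k%:R * x + s) * cos (k%:R * x + t)) = pi * cos (s - t).
Proof.
move=> k0.
rewrite (@eq_itg _ _ (fun x => 2^-1 * (cos (0 * x + (s - t)) + cos ((k + k)%:R * x + (s + t))))).
  rewrite itgZ; last by apply: continuous_add; exact: continuous_cos_affine.
  rewrite itgD; [|exact: continuous_cos_affine..].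
  rewrite itg_cos0 ?addn_gt0 ?k0// addr0.
  under eq_itg do rewrite mul0r add0r.
  by rewrite itg_cst; field.
move=> x; rewrite cosMcos natrD.
by congr (_ * (cos _ + cos _)); ring.
Qed.

(* Orthogonal to all frequencies below [m - i], with value 1 at [c] and
   exponentially small in [i] away from [c]. *)
Definition kernel c i m x := ((1 + cos (x - c)) / 2) ^+ i * cos (m%:R * (x - c)).

Lemma continuous_kernel c i m : continuous (kernel c i m).
Proof.
have cc (d : R) : continuous (fun _ : R => d) by move=> x; exact: cvg_cst.
have c1 d : continuous (fun x => cos (d * (x - c))).
  have := @continuous_cos_affine d (- d * c).
  by under eq_fun do rewrite mulNr -mulrBr.
have cp : continuous (fun x => (1 + cos (x - c)) / 2).
  apply: (@continuous_mul (fun x => 1 + cos (x - c))) => //.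
  apply: (@continuous_add (fun=> 1)) => //.
  by have := c1 1; under eq_fun do rewrite mul1r.
apply: (@continuous_mul (fun x => ((1 + cos (x - c)) / 2) ^+ i)) => // x.
apply: (@continuous_comp _ _ _ (fun x => (1 + cos (x - c)) / 2) (@GRing.exp R ^~ i)); first exact: cp.
exact: exprn_continuous.
Qed.

(** Product formula: [cos z * cos (m z)] is the average of the cosines of frequencies [m + 1] and
    [m - 1]. *)
Lemma kernelS c i m x : (0 < m)%N ->
  kernel c i.+1 m x = 2^-1 * kernel c i m x + 4^-1 * kernel c i m.+1 x + 4^-1 * kernel c i m.-1 x.
Proof.
case: m => // m _; rewrite /kernel exprS /=.
move: (x - c) => z; move: (_ ^+ i) => w.
have e1 : m.+2%:R * z = m.+1%:R * z + z by rewrite -[in LHS]natr1; ring.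
have e2 : m%:R * z = m.+1%:R * z - z by rewrite -[in RHS]natr1; ring.
rewrite e1 e2 cosD cosB; by field.
Qed.

(** Each power of [(1 + cos) / 2] widens the spectrum by one on either side, so the frequencies of
    the kernel stay at or above [m - i], hence above [j]. *)
Lemma itg_cosMkernel c i m j t u : (j + i < m)%N ->
  itg u (u + 2 * pi) (fun x => cos (j%:R * x + t) * kernel c i m x) = 0.
Proof.
elim: i m => [|i IH] m jm.
  rewrite -(@itg_cosMcos_neq j m t (- m%:R * c) u); last by rewrite neq_ltn -[j]addn0 jm.
  by apply: eq_itg => x; rewrite /kernel expr0 mul1r mulrBr mulNr.
have m0 : (0 < m)%N by rewrite (leq_ltn_trans _ jm).
have cck n : continuous (fun x => cos (j%:R * x + t) * kernel c i n x).
  by apply: continuous_mul; [exact: continuous_cos_affine | exact: continuous_kernel].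
rewrite (@eq_itg _ _ (fun x => 2^-1 * (cos (j%:R * x + t) * kernel c i m x)
  + 4^-1 * (cos (j%:R * x + t) * kernel c i m.+1 x)
  + 4^-1 * (cos (j%:R * x + t) * kernel c i m.-1 x))); last first.
  by move=> x; rewrite kernelS//; ring.
have cckz n d : continuous (fun x => d * (cos (j%:R * x + t) * kernel c i n x)).
  exact: continuous_scale.
rewrite !itgD ?itgZ ?IH//.
- by rewrite ?mulr0 ?addr0.
- by case: m jm {m0} => //= m; rewrite addnS ltnS.
- by rewrite ltnS (leq_trans (leq_addr 1 _))// addn1 -addnS ltnW.
- by rewrite -addnS ltnW.
- by apply: continuous_add; exact: cckz.
Qed.

(** The [i]-th derivative in closed form: differentiating frequency [k] gives a factor [k] and a
    phase shift [pi / 2]. Since [0 ^+ 0 = 1], the constant term is present at [i = 0] and gone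
    afterwards. *)
Definition trig n a b i x :=
  \sum_(k < n.+1) k%:R ^+ i * (a k * cos (k%:R * x + i%:R * (pi / 2))
                             + b k * sin (k%:R * x + i%:R * (pi / 2))).

Lemma trig_poly_trig n T : trig_poly n T -> exists a b, T = trig n a b 0.
Proof.
move=> [a [b TE]]; exists a, b; apply/funext => x; rewrite TE /trig.
rewrite big_ord_recl !mulr0n !mul0r !addr0 sin0 cos0 mulr0 mulr1 expr0 mul1r addr0.
rewrite big_add1/= big_mkord.
by congr (_ + _); apply: eq_bigr => k _; rewrite /bump/= add1n expr0 mul1r ?mul0r ?addr0.
Qed.

Lemma antiderivative_trig n a b i : antiderivative (trig n a b i) (trig n a b i.+1).
Proof.
apply: antiderivative_sum => k.
have H := antiderivativeZ (k%:R ^+ i) (antiderivativeD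
  (antiderivativeZ (a k) (antiderivative_cos k%:R (i%:R * (pi / 2))))
  (antiderivativeZ (b k) (antiderivative_sin k%:R (i%:R * (pi / 2))))).
apply: antiderivative_ext H => // x.
rewrite -[i.+1%:R]natr1 [(i%:R + 1) * _]mulrDl mul1r !addrA exprS; ring.
Qed.

Lemma tower_trig n a b i : tower i (trig n a b).
Proof.
split=> [j _|]; first exact: antiderivative_trig.
exact: antiderivative_continuous (@antiderivative_trig n a b i).
Qed.

Lemma sin_cosB x : sin x = cos (x - pi / 2).
Proof. by rewrite cosBpihalf. Qed.

Lemma itg_trigM n a b i f u v : continuous f ->
  itg u v (fun x => trig n a b i x * f x) =
  \sum_(k < n.+1) k%:R ^+ i *
   (a k * itg u v (fun x => cos (k%:R * x + i%:R * (pi / 2)) * f x) +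
    b k * itg u v (fun x => cos (k%:R * x + (i%:R * (pi / 2) - pi / 2)) * f x)).
Proof.
move=> cf.
have cc k t : continuous (fun x => cos (k%:R * x + t) * f x).
  by apply: continuous_mul => //; exact: continuous_cos_affine.
rewrite (@eq_itg _ _ (fun x => \sum_(k < n.+1) k%:R ^+ i *
   (a k * (cos (k%:R * x + i%:R * (pi / 2)) * f x) +
    b k * (cos (k%:R * x + (i%:R * (pi / 2) - pi / 2)) * f x)))); last first.
  move=> x; rewrite /trig mulr_suml; apply: eq_bigr => k _.
  rewrite sin_cosB addrA; ring.
rewrite itg_sum; last first.
  by move=> k; apply/continuous_scale/continuous_add; exact: continuous_scale.
apply: eq_bigr => k _; rewrite itgZ; last first.
  by apply/continuous_add; exact: continuous_scale.
by rewrite itgD ?itgZ//; exact: continuous_scale.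
Qed.

Lemma itg_trigMkernel n a b i c m u : (n + n < m)%N ->
  itg u (u + 2 * pi) (fun x => trig n a b i x * kernel c n m x) = 0.
Proof.
move=> nm; rewrite itg_trigM; last exact: continuous_kernel.
apply: big1 => k _; have kn : (k + n < m)%N.
  by rewrite (leq_ltn_trans _ nm)// leq_add2r -ltnS.
by rewrite !itg_cosMkernel// !mulr0 addr0 mulr0.
Qed.

(** Fourier's formulas: pairing with [cos (k x + t)] over a period gives [pi * a k] at [t = 0] and
    [pi * b k] at [t = - pi / 2]. *)
Lemma trig_coef_le n a b k (B : R) : (forall x, `|trig n a b 0 x| <= B) ->
  (0 < k <= n)%N -> `|a k| <= 2 * B /\ `|b k| <= 2 * B.
Proof.
move=> TB /andP[k0 kn].
have key t : `|itg 0 (0 + 2 * pi) (fun x => trig n a b 0 x * cos (k%:R * x + t))| <= pi * (2 * B).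
  have -> : pi * (2 * B) = B * ((0 + 2 * pi) - 0) by ring.
  apply: norm_itg_le => [||x _].
  - by rewrite add0r mulr_ge0// pi_ge0.
  - apply: continuous_mul; last exact: continuous_cos_affine.
    exact: antiderivative_continuous (@antiderivative_trig n a b 0).
  - by rewrite normrM -[B]mulr1 ler_pM// cos_max.
have E t : itg 0 (0 + 2 * pi) (fun x => trig n a b 0 x * cos (k%:R * x + t)) =
    pi * (a k * cos t - b k * sin t).
  rewrite itg_trigM; last exact: continuous_cos_affine.
  rewrite (bigD1 (Ordinal (kn : k < n.+1)%N))//= big1 => [|j jk].
    rewrite !itg_cosMcos_eq// expr0 mulr0n mul0r !sub0r cosN.
    by rewrite -opprD cosN [pi / 2 + t]addrC cosDpihalf; ring.
  have jk' : nat_of_ord j != k by apply: contra_neq jk => jk; apply: val_inj.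
  by rewrite !itg_cosMcos_neq// !mulr0 addr0 mulr0.
have := key 0; have := key (- (pi / 2)); rewrite !E cos0 sin0 mulr0 mulr1 subr0.
rewrite cosN sinN cos_pihalf sin_pihalf mulr0 sub0r mulrN1 opprK !normrM.
by rewrite (gtr0_norm (pi_gt0 R)) !ler_pM2l ?pi_gt0.
Qed.

(** A crude Bernstein inequality from the coefficient bounds. The extra factor [n] does no harm, as
    the bound is only used next to an exponentially small [rho ^+ n]. *)
Lemma trig_derivative_le n a b i (B : R) x : (0 < i)%N -> (forall x, `|trig n a b 0 x| <= B) ->
  `|trig n a b i x| <= 4 * B * n%:R ^+ i.+1.
Proof.
move=> i0 TB; rewrite /trig big_ord_recl/= expr0n eqn0Ngt i0/= mul0r add0r.
apply: le_trans (ler_norm_sum _ _ _) _.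
have -> : 4 * B * n%:R ^+ i.+1 = \sum_(k < n) 4 * B * n%:R ^+ i.
  by rewrite sumr_const card_ord exprS -mulr_natl; ring.
apply: ler_sum => k _.
have kn : (0 < bump 0 k <= n)%N by rewrite /bump/= add1n ltn_ord.
have [ak bk] := trig_coef_le TB kn.
rewrite normrM [leRHS]mulrC ler_pM//.
  by rewrite normrX normr_nat ler_pXn2r ?nnegrE ?ler_nat ?ler0n.
apply: le_trans (ler_normD _ _) _.
rewrite !normrM (_ : 4 * B = 2 * B + 2 * B); last by ring.
have B0 : 0 <= 2 * B by exact: le_trans ak.
by apply: lerD; rewrite -[leRHS]mulr1 ler_pM// ?cos_max ?sin_max.
Qed.

End Trig.

(** * Pairing a high derivative with a polynomial vanishing at the endpoints *)

Section Pairing.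
Variable R : realType.
Implicit Types (P Q S : {poly R}) (U V : nat -> R -> R) (a b c x r h : R) (n k q : nat).

Lemma antiderivative_horner P : antiderivative (horner P) (horner P^`()).
Proof. by move=> x; exact: is_derive_poly. Qed.

(** Integration by parts [k] times; the power of [P] kills every boundary term. [S] depends on the
    polynomials and on [k], not on [U]. *)
Lemma tower_pairing k P Q u v : root P u -> root P v ->
  exists S, forall U, tower k U ->
    itg u v (fun x => U k x * (P ^+ k * Q).[x]) = itg u v (fun x => U 0%N x * S.[x]).
Proof.
move=> /rootP Pu /rootP Pv; elim: k Q => [|k IH] Q.
  by exists Q => U _; apply: eq_itg => x; rewrite expr0 mul1r.
(* Chosen so that the derivative of [P ^+ k.+1 * Q] is [- (P ^+ k * Q')]; the sign cancels the one
   from integration by parts. *)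
pose Q' := - (P^`() * Q *+ k.+1 + P * Q^`()).
have [S HS] := IH Q'; exists S => U tU; rewrite -HS; last exact: tower_le tU.
have dE : (P ^+ k.+1 * Q)^`() = - (P ^+ k * Q').
  by rewrite derivM deriv_exp /Q' exprS -!mulrnAl /=; ring.
rewrite (itg_by_parts u v (tU.1 k (ltnSn k)) (antiderivative_horner (P ^+ k.+1 * Q))); last 2 first.
- exact: tU.2.
- exact: continuous_horner.
rewrite !hornerM !horner_exp Pu Pv !expr0n/= !mul0r !mulr0 subrr sub0r.
rewrite -mulN1r -itgZ; last first.
  by apply: continuous_mul; [exact: tower_continuous tU _ | exact: continuous_horner].
by apply: eq_itg => x; rewrite dE hornerN; ring.
Qed.

(** Uniform closeness of two functions thus controls these functionals of their [k]-th derivatives,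
    with a constant, the integral of [|S|], independent of the functions. *)
Lemma tower_pairing_le k P Q u v : u <= v -> root P u -> root P v ->
  exists2 C, 0 <= C & forall U eta, tower k U -> (forall x, `|U 0%N x| <= eta) ->
    `|itg u v (fun x => U k x * (P ^+ k * Q).[x])| <= C * eta.
Proof.
move=> uv Pu Pv; have [S HS] := tower_pairing k Q Pu Pv.
have cS := @continuous_horner R S.
have cnS : continuous (fun x => `|S.[x]|) by move=> x; apply: cvg_norm; exact: cS.
exists (itg u v (fun x => `|S.[x]|)); first exact: itg_ge0.
move=> U eta tU Ueta; rewrite HS//.
have cU := tower_continuous tU (leq0n k).
have cUS : continuous (fun x => U 0%N x * S.[x]) by exact: continuous_mul.
have le1 x : `|U 0%N x * S.[x]| <= eta * `|S.[x]|.
  by rewrite normrM ler_wpM2r.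
rewrite mulrC ler_norml -mulNr -!itgZ//; apply/andP; split; apply: le_itg => //.
- exact: continuous_scale.
- by move=> x _; have := le1 x; rewrite ler_norml mulNr => /andP[].
- exact: continuous_scale.
- by move=> x _; have := le1 x; rewrite ler_norml => /andP[].
Qed.

End Pairing.

(** * Elementary bounds for the kernel and for geometric decay *)

Section Estimates.
Variable R : realType.
Implicit Types (a b c x z r h v w : R) (n m k q : nat).

Lemma expB_le v w q : 0 <= v <= w -> w <= 1 -> w ^+ q - v ^+ q <= q%:R * (w - v).
Proof.
move=> /andP[v0 vw] w1; elim: q => [|q IH]; first by rewrite !expr0 subrr mul0r.
have vq : 0 <= v ^+ q <= 1 by rewrite exprn_ge0//= exprn_ile1// (le_trans vw).
have -> : w ^+ q.+1 - v ^+ q.+1 = w * (w ^+ q - v ^+ q) + (w - v) * v ^+ q.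
  by rewrite !exprS; ring.
rewrite -[q.+1%:R]natr1 [(q%:R + 1) * _]mulrDl mul1r; apply: lerD; last first.
  by rewrite -[leRHS]mulr1 ler_wpM2l ?subr_ge0//; case/andP: vq.
apply: le_trans IH; rewrite -[leRHS]mul1r ler_wpM2r// subr_ge0.
by rewrite lerXn2r ?nnegrE// (le_trans v0).
Qed.

Lemma cos_ge1B z : 1 - `|z| <= cos z.
Proof.
wlog z0 : z / 0 <= z.
  move=> H; have [|z0] := leP 0 z; first exact: H.
  by have := H (- z); rewrite cosN normrN; apply; rewrite oppr_ge0 ltW.
rewrite ger0_norm//.
have F : antiderivative (fun x => cos x - (1 - x)) (fun x : R => 1 - sin x).
  have H := antiderivativeB (@is_derive_cos R) (antiderivativeB (@antiderivative_cst R 1) (fun x => is_derive_id x 1)).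
  by apply: antiderivative_ext H => // x; rewrite sub0r opprK addrC.
have : cos 0 - (1 - 0) <= cos z - (1 - z).
  by apply: (antiderivative_le F z0) => x _; rewrite subr_ge0 sin_le1.
by rewrite cos0 subr0 subrr subr_ge0.
Qed.

(** Both factors equal 1 at [a] and deviate from it at most linearly, with slopes [n] and [m]. For
    [m] of order [n] this produces the factor [n] in front of the first moment. *)
Lemma one_sub_kernel_le a n m x :
  `|1 - kernel a n m x| <= (n%:R + m%:R) * `|x - a|.
Proof.
rewrite /kernel; set z := x - a; set A := (_ / 2) ^+ n; set B := cos (m%:R * z).
have v01 : 0 <= (1 + cos z) / 2 <= 1 by have := cos_geN1 z; have := cos_le1 z; lra.
have [v0 v1] := andP v01.
have A01 : 0 <= A <= 1 by rewrite exprn_ge0//= exprn_ile1.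
have A1 : 1 - A <= n%:R * `|z|.
  have := @expB_le ((1 + cos z) / 2) 1 n v01 (lexx _); rewrite expr1n => /le_trans; apply.
  apply: ler_wpM2l => //; have := cos_ge1B z; have := normr_ge0 z; lra.
have B1 : 1 - B <= m%:R * `|z|.
  have := cos_ge1B (m%:R * z); rewrite normrM normr_nat /B; lra.
have B01 : B <= 1 by exact: cos_le1.
have -> : 1 - A * B = (1 - A) + A * (1 - B) by ring.
have AB : 0 <= A * (1 - B) <= 1 - B.
  case/andP: A01 => A0 A1'.
  by rewrite mulr_ge0 ?subr_ge0//= -[leRHS]mul1r ler_wpM2r// subr_ge0.
rewrite ger0_norm; lra.
Qed.

(** Up to distance [pi] from [a] the cosine decreases with the distance, so the power factor is
    largest at distance [r]. *)
Lemma norm_kernel_le a n m x r : 0 <= r -> r <= `|x - a| <= pi ->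
  `|kernel a n m x| <= ((1 + cos r) / 2) ^+ n.
Proof.
move=> r0 /andP[rx xpi].
rewrite /kernel normrM -[leRHS]mulr1 ler_pM ?cos_max// normrX.
have v0 z : 0 <= (1 + cos z) / 2 by have := @cos_geN1 R z; lra.
apply: lerXn2r; rewrite ?nnegrE ?normr_ge0 ?v0//; rewrite ger0_norm ?v0//.
have : cos (x - a) <= cos r.
  rewrite -cos_norm le_eqVlt; move: rx; rewrite le_eqVlt => /predU1P[->|rx]; first by rewrite eqxx.
  apply/orP; right; rewrite ltr_cos// in_itv/= ?normr_ge0//= r0/=.
  by rewrite (le_trans _ xpi)// ltW.
lra.
Qed.

(** [rho ^- n] is the exponential of [la * n] and exceeds its Taylor term of order [j + 1]; the
    spare factor [n] beats [e^-1]. *)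
Lemma poly_expn_small (rho : R) j e : 0 < rho < 1 -> 0 < e ->
  \forall n \near \oo, n%:R ^+ j * rho ^+ n < e.
Proof.
move=> /andP[r0 r1] e0; pose la := - ln rho.
have la0 : 0 < la by rewrite oppr_gt0 ln_lt0// r0.
have K0 : 0 < la ^+ j.+1 / j.+1`!%:R by rewrite divr_gt0 ?exprn_gt0// ltr0n fact_gt0.
have [N HN] : exists N : nat, e^-1 / (la ^+ j.+1 / j.+1`!%:R) < N%:R.
  exists (Num.Def.truncn (e^-1 / (la ^+ j.+1 / j.+1`!%:R))).+1; exact: truncnS_gt.
near=> n.
have nN : (N <= n)%N by near: n; exact: nbhs_infty_ge.
have n0 : (0 < n)%N by near: n; exact: nbhs_infty_gt.
have n0' : 0 < n%:R :> R by rewrite ltr0n.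
have E : (rho ^+ n)^-1 = expR (la * n%:R).
  by rewrite mulNr expRN expRM_natr lnK// posrE.
have := @expR_ge1Dxn R (la * n%:R) j (mulr_ge0 (ltW la0) (ltW n0')).
rewrite -E => h.
have h2 : n%:R ^+ j * e^-1 < (rho ^+ n)^-1.
  apply: lt_le_trans h; rewrite exprMn.
  have -> : 1 + la ^+ j.+1 * n%:R ^+ j.+1 / j.+1`!%:R = 1 + n%:R ^+ j * (n%:R * (la ^+ j.+1 / j.+1`!%:R)).
    by rewrite [n%:R ^+ _]exprSr; ring.
  apply: ltr_pwDl => //; apply: ler_wpM2l; first exact: exprn_ge0.
  rewrite -ler_pdivrMr//; apply: le_trans (ltW HN) _.
  by rewrite ler_nat.
have rn0 : 0 < rho ^+ n by rewrite exprn_gt0.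
by move: h2; rewrite ltr_pdivrMr// => h2; rewrite -ltr_pdivlMr// mulrC.
Unshelve. all: by end_near. Qed.

End Estimates.

(** * Concentration of mass near a sign change *)

Section Concentration.
Variable R : realType.
Implicit Types (al be : nat -> R) (U : nat -> R -> R) (a c x z r h : R) (n m k q : nat).

(** Vanishes at [a - r] and [a + r], is positive between them and peaks at [a] with value [r ^+ 2];
    its [q]-th power is the cutoff [psi] used below. *)
Let W a r : {poly R} := (r ^+ 2)%:P - ('X - a%:P) ^+ 2.

Let WE a r x : (W a r).[x] = r ^+ 2 - (x - a) ^+ 2.
Proof. by rewrite /W !hornerE. Qed.

(* Integrated against a polynomial of degree [n] changing sign at [a], the kernel term
   vanishes, which bounds the net mass near [a] by [n] times the first absolute moment. *)
Lemma test_sub_kernel_le a r q : 0 < r <= 1 ->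
  exists2 A : R, 0 < A & forall n x, (0 < n)%N -> a - r <= x <= a + r ->
    `|(W a r).[x] ^+ q - r ^+ 2 ^+ q * kernel a n (n + n).+1 x| <=
      A * n%:R * `|x - a| * (W a r).[x] ^+ q + ((1 + cos (r / 2)) / 2) ^+ n.
Proof.
move=> /andP[r0 r1].
have r20 : 0 < r ^+ 2 by rewrite exprn_gt0.
(* The minimum of the cutoff over the points within [r / 2] of [a]. *)
pose c : R := (3 / 4 * r ^+ 2) ^+ q.
have c0 : 0 < c by rewrite exprn_gt0// mulr_gt0.
(* The first summand serves [|x - a| <= r / 2], where the cutoff is at least [c] and can be inserted
   at the cost of [1 / c]; the second serves the rest, where [2 / r * |x - a|] is at least 1. *)
exists ((q%:R + 4) / c + 2 / r); first by rewrite addr_gt0// divr_gt0// ltr_wpDl.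
move=> n x n0 xar; rewrite WE; set z := x - a.
have n1 : 1 <= n%:R :> R by rewrite ler1n.
have zr : `|z| <= r by rewrite ler_norml /z; lra.
have zz : z ^+ 2 = `|z| ^+ 2 by rewrite real_normK// num_real.
have z0 := normr_ge0 z.
have w1 : 0 <= r ^+ 2 - z ^+ 2 <= r ^+ 2 by rewrite zz; nra.
have r21 : r ^+ 2 <= 1 by rewrite expr_le1// ltW.
set psi := (_ - z ^+ 2) ^+ q; set s := r ^+ 2 ^+ q; set rho := ((1 + _) / 2) ^+ n.
have s01 : 0 <= s <= 1 by rewrite exprn_ge0 ?exprn_ile1// ltW.
have psi0 : 0 <= psi by rewrite exprn_ge0//; case/andP: w1.
have [w10 w11] := andP w1.
have psis : psi <= s by rewrite lerXn2r ?nnegrE ?(ltW r20).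
have rho0 : 0 <= rho.
  by rewrite exprn_ge0//; have := @cos_geN1 R (r / 2); lra.
have [zle|zge] := leP `|z| (r / 2); last first.
  have kr : `|kernel a n (n + n).+1 x| <= rho.
    apply: norm_kernel_le; first by rewrite divr_ge0// ltW.
    rewrite (ltW zge)/=; have := @pi_ge2 R; rewrite -/z; lra.
  apply: le_trans (ler_normB _ _) _; apply: lerD.
    rewrite ger0_norm// -[leLHS]mul1r ler_wpM2r//.
    apply: (@le_trans _ _ (2 / r * `|z|)).
      by rewrite mulrAC ler_pdivlMr// mul1r; lra.
    apply: ler_wpM2r => //; apply: (@le_trans _ _ (((q%:R + 4) / c + 2 / r) * 1)).
      by rewrite mulr1 lerDr divr_ge0// ltW// ltr_wpDl.
    by apply: ler_wpM2l => //; rewrite addr_ge0// divr_ge0 ?(ltW c0)// ltW// ltr_wpDl.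
  rewrite normrM (ger0_norm (proj1 (andP s01))) -[leRHS]mul1r.
  by apply: ler_pM => //; case/andP: s01.
have cpsi : c <= psi.
  apply: lerXn2r; rewrite ?nnegrE//; first by rewrite mulr_ge0// ltW.
  have : z ^+ 2 <= r ^+ 2 / 4 by rewrite zz; nra.
  lra.
(* Both terms have the value [s] at [a]. The deviations are at most [q |z|] and
   [(3 n + 1) |z| <= 4 n |z|], whence the numerator [q + 4]. *)
have -> : psi - s * kernel a n (n + n).+1 x = - (s - psi) + s * (1 - kernel a n (n + n).+1 x).
  by ring.
have spsi : s - psi <= q%:R * `|z|.
  apply: le_trans (expB_le q w1 r21) _; rewrite opprB addrC subrK.
  by apply: ler_wpM2l => //; rewrite zz; nra.
have k1 := one_sub_kernel_le a n (n + n).+1 x.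
apply: ler_wpDr => //.
apply: le_trans (ler_normD _ _) _.
rewrite normrN ger0_norm ?subr_ge0// normrM (ger0_norm (proj1 (andP s01))).
apply: (@le_trans _ _ ((q%:R + 4) * n%:R * `|z|)).
  have sk : s * `|1 - kernel a n (n + n).+1 x| <= 4 * n%:R * `|z|.
    apply: (@le_trans _ _ (1 * `|1 - kernel a n (n + n).+1 x|)).
      by apply: ler_wpM2r => //; case/andP: s01.
    rewrite mul1r; apply: le_trans k1 _; apply: ler_wpM2r => //.
    by rewrite -natr1 natrD; lra.
  have : q%:R * `|z| <= q%:R * n%:R * `|z|.
    by apply: ler_wpM2r => //; rewrite -[leLHS]mulr1 ler_wpM2l.
  lra.
apply: (@le_trans _ _ ((q%:R + 4) * n%:R * `|z| * (psi / c))).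
  rewrite -[leLHS]mulr1; apply: ler_wpM2l; last by rewrite ler_pdivlMr// mul1r.
  by rewrite !mulr_ge0// addr_ge0.
have -> : ((q%:R + 4) / c + 2 / r) * n%:R * `|z| * psi =
    (q%:R + 4) * n%:R * `|z| * (psi / c) + 2 / r * n%:R * `|z| * psi by ring.
by rewrite lerDl !mulr_ge0// invr_ge0 ltW.
Qed.

(** A chain of comparisons: the mass of [U q] is close to that of the polynomial's derivative, which
    is at most [A n] times its first moment, which is close to the first moment of [U q], at most
    [h * m]. Each passage between the two functions costs a multiple of [eta]; the tail of the
    kernel costs the [rho ^+ n] term. *)
Lemma mass_near_sign_change a r q : 0 < r <= 1 ->
  exists c A C rho : R, [/\ 0 < c, 0 < A, 0 <= C, 0 < rho < 1 &
    forall n (h eta S m : R) U al be, (0 < n)%N -> 0 <= h <= r / 2 -> tower q U ->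
      (forall x, a - r <= x <= a + r -> 0 <= trig n al be q x * (x - a)) ->
      (forall x, a - r <= x <= a + r -> 0 <= U q x) ->
      (forall x, a - r <= x <= a + r -> ~~ (a <= x <= a + h) -> U q x = 0) ->
      (forall x, `|U 0%N x - trig n al be 0 x| <= eta) ->
      (forall x, `|trig n al be q x| <= S) ->
      m = itg (a - r) (a + r) (U q) ->
      c * m <= A * n%:R * (h * m + C * eta) + C * eta + 2 * pi * S * rho ^+ n].
Proof.
move=> r01; have [A A0 HA] := test_sub_kernel_le a q r01.
have [r0 r1] := andP r01.
have r20 : 0 < r ^+ 2 by rewrite exprn_gt0.
have r21 : r ^+ 2 <= 1 by rewrite expr_le1// ltW.
have uv : a - r <= a + r by lra.
have Wu : root (W a r) (a - r) by apply/rootP; rewrite WE; ring.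
have Wv : root (W a r) (a + r) by apply/rootP; rewrite WE; ring.
(* The cofactors [1] and ['X - a%:P] give the weighted mass and the weighted first moment. *)
have [C1 C10 HC1] := tower_pairing_le q 1 uv Wu Wv.
have [C2 C20 HC2] := tower_pairing_le q ('X - a%:P) uv Wu Wv.
pose c : R := (3 / 4 * r ^+ 2) ^+ q.
have c0 : 0 < c by rewrite exprn_gt0// mulr_gt0.
pose rho : R := (1 + cos (r / 2)) / 2.
have rho01 : 0 < rho < 1.
  have /andP[cr0 cr1] : 0 < cos (r / 2) < 1.
    rewrite cos_gt0_pihalf/=; last by have := @pi_ge2 R; lra.
    rewrite -[X in _ < X]cos0 ltr_cos ?in_itv/=; have := @pi_ge2 R; lra.
  rewrite /rho; lra.
exists c, A, (C1 + C2), rho; split => //; first exact: addr_ge0.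
move=> n h eta S m U al be n0 /andP[h0 hr] tU Tsgn U0 Uh UT TS mE.
pose T := trig n al be.
have tT i : tower i T := tower_trig n al be i.
have cT : continuous (T q) := (tT q).2.
have cU : continuous (U q) := tU.2.
have eta0 : 0 <= eta by exact: le_trans (UT 0).
have S0 : 0 <= S by exact: le_trans (TS 0).
have m0 : 0 <= m by rewrite mE; apply: itg_ge0.
pose psi := fun x => (W a r).[x] ^+ q.
have cpsi : continuous psi.
  have -> : psi = horner (W a r ^+ q) by apply/funext => x; rewrite horner_exp.
  exact: continuous_horner.
have cid : continuous (fun x : R => x - a).
  by apply: continuous_sub => x; [exact: cvg_id | exact: cvg_cst].
have psi01 x : a - r <= x <= a + r -> 0 <= psi x <= 1.
  move=> xar; rewrite /psi WE.
  have : 0 <= r ^+ 2 - (x - a) ^+ 2 <= 1.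
    have := sqr_ge0 (x - a); have : 0 <= (r - (x - a)) * (r + (x - a)) by rewrite mulr_ge0; lra.
    lra.
  by move=> /andP[w0 w1]; rewrite exprn_ge0//= exprn_ile1.
have tUT : tower q (fun i x => U i x - T i x) := towerB tU (tT q).
have D1 := HC1 _ _ tUT UT; have D2 := HC2 _ _ tUT UT.
have E1 : itg (a - r) (a + r) (fun x => (U q x - T q x) * (W a r ^+ q * 1).[x]) =
    itg (a - r) (a + r) (fun x => U q x * psi x) - itg (a - r) (a + r) (fun x => T q x * psi x).
  rewrite -itgB; [|exact: continuous_mul..].
  by apply: eq_itg => x; rewrite hornerM horner_exp hornerC mulr1 mulrBl.
have E2 : itg (a - r) (a + r) (fun x => (U q x - T q x) * (W a r ^+ q * ('X - a%:P)).[x]) =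
    itg (a - r) (a + r) (fun x => U q x * ((x - a) * psi x))
    - itg (a - r) (a + r) (fun x => T q x * ((x - a) * psi x)).
  rewrite -itgB; [|by apply: continuous_mul => //; exact: continuous_mul..].
  by apply: eq_itg => x; rewrite hornerM horner_exp hornerXsubC mulrBl ![psi x * _]mulrC.
have cchi : continuous (fun x => (x - a) * psi x) by exact: continuous_mul.
(* [h <= r / 2] keeps the support of [U q] where the cutoff is at least [c]. *)
have G1 : c * m <= itg (a - r) (a + r) (fun x => U q x * psi x).
  rewrite mE -itgZ//; apply: le_itg => //; [exact: continuous_scale|exact: continuous_mul|].
  move=> x xar; have [xah|xah] := boolP (a <= x <= a + h); last first.
    by rewrite Uh// mulr0 mul0r.
  rewrite mulrC ler_wpM2l// ?U0// /psi WE.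
  have xr : 3 / 4 * r ^+ 2 <= r ^+ 2 - (x - a) ^+ 2.
    have : 0 <= (r / 2 - (x - a)) * (r / 2 + (x - a)) by rewrite mulr_ge0; lra.
    lra.
  have r34 : 0 <= 3 / 4 * r ^+ 2 by rewrite mulr_ge0// ltW.
  by apply: lerXn2r; rewrite ?nnegrE// (le_trans r34).
have G2 : itg (a - r) (a + r) (fun x => U q x * ((x - a) * psi x)) <= h * m.
  rewrite mE -itgZ//; apply: le_itg => //; [exact: continuous_mul|exact: continuous_scale|].
  move=> x xar; have [xah|xah] := boolP (a <= x <= a + h); last first.
    by rewrite Uh// mulr0 mul0r.
  rewrite mulrC ler_wpM2r// ?U0//.
  have /andP[p0 p1] := psi01 x xar.
  by rewrite -[leRHS]mulr1 ler_pM//; lra.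
pose kap := kernel a n (n + n).+1.
have ck : continuous kap by exact: continuous_kernel.
have cTk : continuous (fun x => T q x * kap x) by exact: continuous_mul.
pose s := r ^+ 2 ^+ q.
have s01 : 0 <= s <= 1 by rewrite exprn_ge0 ?exprn_ile1// ltW.
have rn0 : 0 <= rho ^+ n by rewrite exprn_ge0//; case/andP: rho01 => /ltW.
have out u v : u <= v -> (forall x, u <= x <= v -> r / 2 <= `|x - a| <= pi) ->
    `|itg u v (fun x => T q x * kap x)| <= S * rho ^+ n * (v - u).
  move=> uv' H; apply: norm_itg_le => // x xuv; rewrite normrM; apply: ler_pM => //.
  by apply: norm_kernel_le; [rewrite divr_ge0// ltW|exact: H].
have pi2 := @pi_ge2 R.
(* Over a full period the integral is 0, because [(n + n).+1] exceeds the degree [n] plus the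
   spectral width [n]. The inner part is therefore minus the outer part, where the kernel is at most
   [rho ^+ n]. *)
have K0 : `|itg (a - r) (a + r) (fun x => T q x * kap x)| <= S * rho ^+ n * (2 * pi - 2 * r).
  have := @itg_trigMkernel R n al be q a (n + n).+1 (a - pi) (ltnSn _).
  rewrite (_ : a - pi + 2 * pi = a + pi); last by ring.
  rewrite (itg_cat (a - r)) (@itg_cat _ (a + r) _ (a - r)) -/kap -/T.
  have := out (a - pi) (a - r) (ltac:(lra)) => H1.
  have := out (a + r) (a + pi) (ltac:(lra)) => H2.
  have {}H1 : `|itg (a - pi) (a - r) (fun x => T q x * kap x)| <= S * rho ^+ n * (a - r - (a - pi)).
    by apply: H1 => x /andP[x1 x2]; clear - pi2 r0 r1 x1 x2; rewrite ler0_norm; lra.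
  have {}H2 : `|itg (a + r) (a + pi) (fun x => T q x * kap x)| <= S * rho ^+ n * (a + pi - (a + r)).
    by apply: H2 => x /andP[x1 x2]; clear - pi2 r0 r1 x1 x2; rewrite ger0_norm; lra.
  have -> : S * rho ^+ n * (2 * pi - 2 * r) = S * rho ^+ n * (a - r - (a - pi)) + S * rho ^+ n * (a + pi - (a + r)).
    by ring.
  move=> E; have -> : itg (a - r) (a + r) (fun x => T q x * kap x) =
    - (itg (a - pi) (a - r) (fun x => T q x * kap x) + itg (a + r) (a + pi) (fun x => T q x * kap x)) by lra.
  by rewrite normrN; apply: le_trans (ler_normD _ _) _; exact: lerD.
have K1 : itg (a - r) (a + r) (fun x => T q x * (psi x - s * kap x)) <=
    A * n%:R * itg (a - r) (a + r) (fun x => T q x * ((x - a) * psi x)) + S * rho ^+ n * (2 * r).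
  rewrite -itgZ; last exact: continuous_mul.
  have -> : 2 * r = (a + r) - (a - r) by ring.
  rewrite -itg_cst -itgD; last 2 first.
  - by apply: continuous_scale; exact: continuous_mul.
  - by move=> x; exact: cvg_cst.
  apply: le_itg => //.
  - by apply: continuous_mul => //; apply: continuous_sub => //; exact: continuous_scale.
  - apply: continuous_add; last by move=> x; exact: cvg_cst.
    by apply: continuous_scale; exact: continuous_mul.
  move=> x xar; apply: le_trans (ler_norm _) _; rewrite normrM.
  apply: le_trans (ler_wpM2l (normr_ge0 _) (HA n x n0 xar)) _.
  rewrite mulrDr; apply: lerD; last by apply: ler_wpM2r => //; exact: TS.
  have /andP[p0 _] := psi01 x xar.
  (* The sign change at [a] is used here: the signed first moment is the absolute one. *)
  have -> : T q x * ((x - a) * psi x) = `|T q x| * `|x - a| * psi x.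
    by rewrite mulrA -normrM ger0_norm//; exact: Tsgn.
  by rewrite -/(psi x) le_eqVlt; apply/orP; left; apply/eqP; ring.
have K2 : itg (a - r) (a + r) (fun x => T q x * psi x) =
    itg (a - r) (a + r) (fun x => T q x * (psi x - s * kap x))
    + s * itg (a - r) (a + r) (fun x => T q x * kap x).
  rewrite -itgZ// -itgD; last 2 first.
  - by apply: continuous_mul => //; apply: continuous_sub => //; exact: continuous_scale.
  - exact: continuous_scale.
  by apply: eq_itg => x; ring.
have K3 : s * itg (a - r) (a + r) (fun x => T q x * kap x) <= S * rho ^+ n * (2 * pi - 2 * r).
  apply: le_trans K0; apply: le_trans (ler_norm _) _.
  rewrite normrM (ger0_norm (proj1 (andP s01))) -[leRHS]mul1r ler_wpM2r//.
  by case/andP: s01.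
move: D1 D2; rewrite E1 E2 !ler_norml => /andP[_ D1] /andP[D2 _].
have K4 : A * n%:R * itg (a - r) (a + r) (fun x => T q x * ((x - a) * psi x)) <=
    A * n%:R * (h * m + C2 * eta).
  by apply: ler_wpM2l; [rewrite mulr_ge0// ltW|lra].
have K5 : A * n%:R * (h * m + C2 * eta) <= A * n%:R * (h * m + (C1 + C2) * eta).
  apply: ler_wpM2l; first by rewrite mulr_ge0// ltW.
  by rewrite lerD2l ler_wpM2r// lerDr.
have K6 : C1 * eta <= (C1 + C2) * eta by rewrite ler_wpM2r// lerDl.
have -> : 2 * pi * S * rho ^+ n = S * rho ^+ n * (2 * r) + S * rho ^+ n * (2 * pi - 2 * r) by ring.
lra.
Qed.

End Concentration.

(** * Lower bound for the error of shape-preserving approximation *)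

Section LowerBound.
Variable R : realType.
Implicit Types (T g : R -> R) (U : nat -> R -> R) (a x r h mu B eta : R) (n k q s D : nat) (y : nat -> R).

Lemma le_supnorm g B x : (forall z, `|g z| <= B) -> `|g x| <= supnorm g.
Proof.
move=> gB; apply: ub_le_sup; last by exists x.
by exists B => _ [z _ <-].
Qed.

Lemma trig_bounded n al be i : exists B : R, forall x, `|trig n al be i x| <= B.
Proof.
exists (\sum_(k < n.+1) k%:R ^+ i * (`|al k| + `|be k|)) => x.
apply: le_trans (ler_norm_sum _ _ _) _; apply: ler_sum => k _.
rewrite normrM normrX normr_nat ler_wpM2l ?exprn_ge0//.
apply: le_trans (ler_normD _ _) _; rewrite !normrM.
by apply: lerD; rewrite -[leRHS]mulr1 ler_pM// ?cos_max ?sin_max.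
Qed.

Lemma En_ge q s y n g eta : (2 <= q)%N ->
  (forall T, trig_poly n T -> Delta q s y T -> eta <= supnorm (fun x => g x - T x)) ->
  eta <= En q s y n g.
Proof.
move=> q2 H; apply: lb_le_inf.
  (* The zero polynomial is admissible, so the infimum runs over a nonempty set. *)
  exists (supnorm (fun x => g x - 0)), (fun=> 0) => //; split.
    exists (fun=> 0), (fun=> 0) => x.
    by rewrite big1 ?addr0// => i _; rewrite !mul0r addr0.
  apply: (@tower_Delta R q s y (fun _ _ => 0)) => //; try exact: tower_cst0.
by move=> _ [T [TT DT] <-]; exact: H.
Qed.

(** [y 1] separates the arc of index 2 on its left, with sign -1, from the arc of index 1 on its
    right, with sign +1; [r] is below both lengths. *)
Lemma Delta_sign_change q s y n al be r x : (2 <= q)%N -> (0 < s)%N ->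
  r < y (2 * s)%N + 2 * pi - y 1%N -> r < y 1%N - y 2%N ->
  Delta q s y (trig n al be 0) ->
  y 1%N - r <= x <= y 1%N + r -> 0 <= trig n al be q x * (x - y 1%N).
Proof.
move=> q2 s0 r0 r2 DT /andP[x1 x2].
have := @Delta_tower R q s y (trig n al be) _ _ q2 (tower_trig n al be q) DT.
move=> H; have [xa|ax|->] := ltgtP x (y 1%N); last by rewrite subrr mulr0.
- have i2 : (1 <= 2 <= 2 * s)%N by rewrite /= leq_pmulr.
  have := H 2%N x i2; rewrite /yext/= expr1 mulN1r oppr_ge0 => h.
  by rewrite nmulr_lge0 ?subr_lt0// h//; apply/andP; split; lra.
- have i1 : (1 <= 1 <= 2 * s)%N by rewrite /= muln_gt0.
  have := H 1%N x i1; rewrite /yext/= expr0 mul1r => h.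
  by rewrite mulr_ge0 ?subr_ge0 ?(ltW ax)// h//; apply/andP; split; lra.
Qed.

(** [h] and [n] are fixed before [U] is known, which permits choosing the widths of all bumps first
    and only then assembling the function. *)
Lemma En_concentrated_gt q s D y (eps : nat -> R) k r mu B :
  (2 <= q)%N -> (0 < s)%N -> eps n @[n --> \oo] --> +oo ->
  0 < r <= 1 -> r < y (2 * s)%N + 2 * pi - y 1%N -> r < y 1%N - y 2%N ->
  0 < mu -> 0 <= B ->
  exists h n, [/\ 0 < h <= r, (k <= n)%N, (0 < n)%N &
    forall U, tower q U ->
      (forall x, y 1%N - r <= x <= y 1%N + r -> 0 <= U q x) ->
      (forall x, y 1%N - r <= x <= y 1%N + r ->
         ~~ (y 1%N <= x <= y 1%N + h) -> U q x = 0) ->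
      mu * h ^+ D.+1 <= itg (y 1%N - r) (y 1%N + r) (U q) ->
      (forall x, `|U 0%N x| <= B) ->
      k%:R < eps n * n%:R ^+ (D + 2) * En q s y n (U 0%N)].
Proof.
move=> q2 s0 epsoo r01 ry0 ry2 mu0 B0.
have [c [A [C [rho [c0 A0 C0 rho01 core]]]]] := mass_near_sign_change (y 1%N) q r01.
have [r0 r1] := andP r01.
(* With [h = L / n] the moment term [A n h m] equals [c / 2 * m] and is absorbed by the left
   side. *)
pose L := c / (2 * A).
have L0 : 0 < L by rewrite divr_gt0// mulr_gt0.
(* After multiplication by [n ^ (D + 1)] the left side is at least the constant [E]. [F / eps n]
   bounds the term in [eta], and [G] is the coefficient of the exponentially small remainder; [n] is
   taken so large that each falls below [E / 2]. *)
pose E := c / 2 * mu * L ^+ D.+1.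
have E0 : 0 < E by rewrite mulr_gt0 ?exprn_gt0// mulr_gt0// divr_gt0.
pose F := (A + 1) * C * (k%:R + 1) : R.
have F0 : 0 <= F by rewrite !mulr_ge0// addr_ge0// ltW.
pose G := 8 * pi * (B + k%:R + 1) : R.
have G0 : 0 < G by rewrite mulr_gt0 ?mulr_gt0 ?pi_gt0// ltr_wpDl// addr_ge0.
have EG : 0 < E / 2 / G by rewrite !divr_gt0.
have : \forall n \near \oo, [/\ (k < n)%N, L / (r / 2) <= n%:R, 1 < eps n, F / (E / 2) < eps n
   & n%:R ^+ (q.+1 + D.+1) * rho ^+ n < E / 2 / G].
  have [N HN] : exists N : nat, L / (r / 2) < N%:R.
    by exists (Num.Def.truncn (L / (r / 2))).+1; exact: truncnS_gt.
  near=> n; split.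
  - by near: n; exact: nbhs_infty_gt.
  - apply: le_trans (ltW HN) _; rewrite ler_nat; near: n; exact: nbhs_infty_ge.
  - by near: n; exact: (cvgry_gt epsoo).
  - by near: n; exact: (cvgry_gt epsoo).
  - by near: n; exact: poly_expn_small.
move=> [N _ /(_ N (leqnn N))[]]; set n := N => kn Ln eps1 epsF small.
have n0 : (0 < n)%N by exact: leq_ltn_trans kn.
have n0' : 0 < n%:R :> R by rewrite ltr0n.
have n1' : 1 <= n%:R :> R by rewrite ler1n.
have h0 : 0 < L / n%:R by rewrite divr_gt0.
have hr : L / n%:R <= r / 2.
  by rewrite ler_pdivrMr// mulrC -ler_pdivrMr// divr_gt0.
have eps0 : 0 < eps n by exact: lt_trans eps1.
have nD0 : 0 < n%:R ^+ (D + 2) :> R by rewrite exprn_gt0.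
have eD0 : 0 < eps n * n%:R ^+ (D + 2) by rewrite mulr_gt0.
exists (L / n%:R), n; split => //; first by rewrite h0/=; lra.
  exact: ltnW.
move=> U tU Upos Uzero Umass UB.
(* The threshold uses [k + 1] to leave a strict inequality; an admissible [T] with error below it is
   then refuted. *)
apply: (@lt_le_trans _ _ (eps n * n%:R ^+ (D + 2) * ((k%:R + 1) / (eps n * n%:R ^+ (D + 2))))).
  by rewrite mulrC divfK ?gt_eqF// ltrDl.
apply: ler_wpM2l; first exact: ltW.
apply: En_ge => // T /trig_poly_trig[al [be ->]] DT.
rewrite leNgt; apply/negP => eta_lt.
set eta := supnorm _ in eta_lt.
have [BT HBT] := trig_bounded n al be 0.
have Ueta x : `|U 0%N x - trig n al be 0 x| <= eta.
  apply: (@le_supnorm (fun x => U 0%N x - trig n al be 0 x) (B + BT)) => z.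
  by apply: le_trans (ler_normB _ _) _; apply: lerD.
have eta0 : 0 <= eta by exact: le_trans (Ueta 0).
have etaD : eta * n%:R ^+ (D + 2) <= (k%:R + 1) / eps n.
  by rewrite ler_pdivlMr// -mulrA [_ * eps n]mulrC -ler_pdivlMr// ltW.
have ek : (k%:R + 1) / eps n <= k%:R + 1.
  by rewrite ler_pdivrMr// ler_peMr ?addr_ge0// ltW.
have etak : eta <= k%:R + 1.
  apply: le_trans ek; apply: le_trans etaD.
  by rewrite ler_peMr// exprn_ege1.
have TB x : `|trig n al be 0 x| <= B + eta.
  have -> : trig n al be 0 x = U 0%N x - (U 0%N x - trig n al be 0 x) by ring.
  by apply: le_trans (ler_normB _ _) _; apply: lerD.
have q0 : (0 < q)%N by exact: leq_trans q2.
have h02 : 0 <= L / n%:R <= r / 2 by rewrite hr ltW.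
have := core n (L / n%:R) eta (4 * (B + eta) * n%:R ^+ q.+1)
  (itg (y 1%N - r) (y 1%N + r) (U q)) U al be n0 h02 tU
  (fun x => Delta_sign_change q2 s0 ry0 ry2 DT) Upos Uzero Ueta
  (fun x => trig_derivative_le x q0 TB) erefl.
set m := itg _ _ _ in Umass * => main.
have AL : A * n%:R * (L / n%:R) = c / 2.
  by rewrite /L; field; rewrite !gt_eqF.
have An : A * n%:R * (L / n%:R * m + C * eta) = c / 2 * m + A * n%:R * (C * eta).
  by rewrite mulrDr mulrA AL.
have main2 : c / 2 * m <= (A + 1) * C * n%:R * eta + 2 * pi * (4 * (B + eta) * n%:R ^+ q.+1) * rho ^+ n.
  have : C * eta <= C * n%:R * eta by rewrite ler_wpM2r// ler_peMr.
  move: main; rewrite An; lra.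
have P0 : 0 < n%:R ^+ D.+1 :> R by rewrite exprn_gt0.
have main3 : E <= (A + 1) * C * (eta * n%:R ^+ (D + 2)) + 8 * pi * (B + eta) * (n%:R ^+ (q.+1 + D.+1) * rho ^+ n).
  have -> : E = c / 2 * (mu * (L / n%:R) ^+ D.+1) * n%:R ^+ D.+1.
    by rewrite /E [(L / n%:R) ^+ _]expr_div_n !mulrA divfK ?gt_eqF.
  apply: (@le_trans _ _ (c / 2 * m * n%:R ^+ D.+1)).
    by apply: ler_wpM2r; [exact: ltW | apply: ler_wpM2l => //; rewrite divr_ge0// ltW].
  apply: le_trans (ler_wpM2r (ltW P0) main2) _.
  rewrite [n%:R ^+ (q.+1 + D.+1)]exprD addn2 [n%:R ^+ D.+2]exprS.
  rewrite le_eqVlt; apply/orP; left; apply/eqP; ring.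
have rn0 : 0 <= rho ^+ n by rewrite exprn_ge0//; case/andP: rho01 => /ltW.
have part1 : (A + 1) * C * (eta * n%:R ^+ (D + 2)) < E / 2.
  apply: (@le_lt_trans _ _ (F / eps n)).
    rewrite /F -[leRHS]mulrA; apply: ler_wpM2l => //.
    by rewrite mulr_ge0// addr_ge0// ltW.
  by rewrite ltr_pdivrMr// mulrC -ltr_pdivrMr// divr_gt0.
have part2 : 8 * pi * (B + eta) * (n%:R ^+ (q.+1 + D.+1) * rho ^+ n) < E / 2.
  apply: (@le_lt_trans _ _ (G * (n%:R ^+ (q.+1 + D.+1) * rho ^+ n))).
    apply: ler_wpM2r; first by rewrite mulr_ge0// exprn_ge0.
    rewrite /G; apply: ler_wpM2l; first by rewrite mulr_ge0// pi_ge0.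
    by rewrite -addrA lerD2l.
  by rewrite mulrC -ltr_pdivlMr.
lra.
Unshelve. all: by end_near. Qed.

End LowerBound.

(** * Construction of the function *)

Section Bump.
Variable R : realType.
Implicit Types (a b c t x z w : R) (i k D : nat).

Definition pospow k z : R := Num.max z 0 ^+ k.

Lemma pospowS k z : pospow k.+2 z = pospow k.+1 z * z.
Proof.
rewrite /pospow; have [z0|z0] := leP z 0; first by rewrite !expr0n/= mul0r.
by rewrite exprSr.
Qed.

Lemma continuous_pospow k : continuous (pospow k).
Proof.
move=> x; apply: (@continuous_comp _ _ _ (fun z => Num.max z 0) (@GRing.exp R ^~ k)); last exact: exprn_continuous.
apply: (@continuous_max R R id (fun=> 0) x); [exact: cvg_id | exact: cvg_cst].
Qed.

Lemma antiderivative_pospow k :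
  antiderivative (pospow k.+2) (fun z => k.+2%:R * pospow k.+1 z).
Proof.
move=> x; have [x0|x0|->] := ltgtP x 0.
- apply: (@near_eq_is_derive _ _ _ (fun=> 0)).
    near=> z; rewrite /pospow max_r ?expr0n//; apply: ltW.
    by near: z; exact: lt_nbhsl.
  rewrite /pospow max_r ?(ltW x0)// expr0n/= mulr0.
  exact: is_derive_cst.
- apply: (@near_eq_is_derive _ _ _ (fun z => z ^+ k.+2)).
    near=> z; rewrite /pospow max_l//; apply: ltW.
    by near: z; exact: lt_nbhsr.
  rewrite /pospow max_l ?(ltW x0)//.
  have := @antiderivative_horner R 'X^(k.+2) x.
  rewrite derivXn hornerMn hornerXn mulr_natl.
  by congr (is_derive _ _ _ _); apply/funext => z; rewrite hornerXn.
- rewrite {2}/pospow maxxx expr0n/= mulr0.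
  (* By [pospowS] the difference quotient at 0 is [pospow k.+1] itself, continuous with value 0
     there. *)
  apply/is_derive1_caratheodory; exists (pospow k.+1); split.
  + move=> z; rewrite pospowS {2}/pospow maxxx expr0n/= subr0 subr0.
    by [].
  + exact: continuous_pospow.
  + by rewrite /pospow maxxx expr0n.
Unshelve. all: by end_near. Qed.

(** Positive exactly on [(1/2, 1)]. Staying away from 0 leaves room beside the accumulation point
    for all later, narrower bumps. *)
Let W : {poly R} := ('X - (2^-1)%:P) * (1 - 'X).

Let WE t : W.[t] = (t - 2^-1) * (1 - t).
Proof. by rewrite /W !hornerE. Qed.

(* With [m = D + 2 - i]: [(W_+^m Q)' = W_+^(m-1) (m W' Q + W Q')] wherever [m >= 2]. *)
Fixpoint bump_factor D i : {poly R} :=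
  if i is j.+1 then
    (D.+2 - j)%:R *: (W^`() * bump_factor D j) + W * (bump_factor D j)^`()
  else 1.

(** The [i]-th derivative of the positive part of [W] to the power [D + 2]; for [i <= D] the
    exponent stays at least 2. *)
Definition bump D i t := pospow (D.+2 - i) W.[t] * (bump_factor D i).[t].

Lemma tower_bump D : tower D (bump D).
Proof.
split=> [i iD|]; last first.
  apply: continuous_mul; last exact: continuous_horner.
  move=> x; apply: (@continuous_comp _ _ _ (horner W)); first exact: continuous_horner.
  exact: continuous_pospow.
have E : (D.+2 - i = (D - i).+2)%N by rewrite !subSn// ?leqW// ltnW.
have E' : (D.+2 - i.+1 = (D - i).+1)%N by rewrite subSS subSn// ltnW.
have H : antiderivative (fun t => pospow (D.+2 - i) W.[t])
    (fun t => (D.+2 - i)%:R * pospow (D.+2 - i.+1) W.[t] * W^`().[t]).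
  move=> t; have := @is_derive1_comp R (pospow (D - i).+2) (horner W) t _ _
    (@antiderivative_pospow (D - i) W.[t]) (antiderivative_horner W t).
  by rewrite E E'.
apply: antiderivative_ext (antiderivativeM H (antiderivative_horner (bump_factor D i))) => // t.
rewrite /bump E E' pospowS /= E hornerD hornerZ !hornerM.
move: (W.[t]) (W^`().[t]) => w w'; ring.
Qed.

Lemma bump_eq0 D i t : (i <= D)%N -> ~~ (2^-1 < t < 1) -> bump D i t = 0.
Proof.
move=> iD tn; rewrite /bump !subSn ?leqW// /pospow max_r; first by rewrite expr0n mul0r.
rewrite WE; move: tn; rewrite negb_and -!leNgt => /orP[h|h].
  by rewrite mulr_le0_ge0; lra.
by rewrite mulr_ge0_le0; lra.
Qed.

Lemma bump_ge0 D t : 0 <= bump D 0 t.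
Proof. by rewrite /bump hornerC mulr1 exprn_ge0// le_max lexx orbT. Qed.

Lemma bump_bounded D : exists2 B, 0 < B & forall i t, (i <= D)%N -> `|bump D i t| <= B.
Proof.
have one i : (i <= D)%N -> exists2 B, 0 < B & forall t, `|bump D i t| <= B.
  move=> iD; have cb := tower_continuous (tower_bump D) iD.
  have [c _ Hc] := @EVT_max R (fun t => `|bump D i t|) 2^-1 1 (ltac:(lra))
    (continuous_subspaceT (fun x => cvg_norm (cb x))).
  exists (`|bump D i c| + 1); first by rewrite ltr_wpDl.
  move=> t; have [tn|tn] := boolP (2^-1 < t < 1).
    apply: le_trans (Hc t _) _; last by rewrite lerDl.
    by rewrite in_itv/=; case/andP: tn => t1 t2; rewrite !ltW.
  by rewrite bump_eq0// normr0 addr_ge0.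
have : forall n, (n <= D)%N -> exists2 B, 0 < B & forall i t, (i <= n)%N -> `|bump D i t| <= B.
  elim=> [|n IH] nD.
    have [B B0 HB] := one 0%N nD; exists B => // i t.
    by rewrite leqn0 => /eqP ->.
  have [B B0 HB] := one _ nD; have [B' B0' HB'] := IH (ltnW nD).
  exists (B + B'); first exact: addr_gt0.
  move=> i t; rewrite leq_eqVlt => /predU1P[->|ni].
    by apply: le_trans (HB _) _; rewrite lerDl ltW.
  by apply: le_trans (HB' _ _ ni) _; rewrite lerDr ltW.
by move=> /(_ D (leqnn D)).
Qed.

Lemma itg_bump_gt0 D : 0 < itg 0 1 (bump D 0).
Proof.
have cb := tower_continuous (tower_bump D) (leq0n D).
have ge0 u v : u <= v -> 0 <= itg u v (bump D 0).
  by move=> uv; apply: itg_ge0 => // x _; exact: bump_ge0.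
rewrite (itg_cat (5 / 8)) (@itg_cat _ (7 / 8) _ (5 / 8)).
apply: ltr_wpDl; first by apply: ge0; lra.
apply: ltr_pwDl; last by apply: ge0; lra.
apply: (@lt_le_trans _ _ (itg (5 / 8) (7 / 8) (fun=> (64^-1 : R) ^+ D.+2))).
  by rewrite itg_cst mulr_gt0// ?exprn_gt0//; lra.
apply: le_itg => //; [by lra|by move=> x; exact: cvg_cst|].
move=> x /andP[x1 x2]; rewrite /bump hornerC mulr1 subn0 WE /pospow.
apply: lerXn2r; rewrite ?nnegrE//; first by rewrite le_max lexx orbT.
rewrite le_max; apply/orP; left.
have : 0 <= (x - 5 / 8) * (7 / 8 - x) by rewrite mulr_ge0; lra.
lra.
Qed.

End Bump.

(** * Series with weights [2^-k] and their termwise differentiation *)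

Section DyadicSeries.
Variable R : realType.
Implicit Types (v : nat -> R) (phi : nat -> nat -> R -> R) (B K x u w : R) (i k N D : nat).

Lemma half_pow_small K e : 0 < e -> exists N0, forall N, (N0 <= N)%N -> K * 2^-1 ^+ N < e.
Proof.
move=> e0; have h : 0 < (2^-1 : R) < 1 by lra.
have K1 : 0 < `|K| + 1 by rewrite ltr_wpDl.
have [N0 _ HN] := poly_expn_small 0 h (divr_gt0 e0 K1).
exists N0 => N /HN; rewrite expr0 mul1r ltr_pdivlMr// => h2.
apply: le_lt_trans h2; rewrite mulrC; apply: ler_wpM2l; first by rewrite exprn_ge0// invr_ge0.
by apply: le_trans (ler_norm _) _; rewrite lerDl.
Qed.

Lemma le_of_dyadic K u w N0 : (forall N, (N0 <= N)%N -> u <= w + K * 2^-1 ^+ N) -> u <= w.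
Proof.
move=> H; apply/ler_addgt0Pr => e e0; have [N1 HN1] := half_pow_small K e0.
have N01 : (N0 <= N0 + N1)%N by rewrite leq_addr.
by apply: le_trans (H _ N01) _; rewrite lerD2l ltW// HN1// leq_addl.
Qed.

Definition dyadic_sum v N : R := \sum_(k < N) 2^-1 ^+ k * v k.

Lemma dyadic_sum_tail v B N j : (forall k, `|v k| <= B) ->
  `|dyadic_sum v (N + j) - dyadic_sum v N| <= 2 * B * (2^-1 ^+ N - 2^-1 ^+ (N + j)).
Proof.
move=> vB; elim: j => [|j IH]; first by rewrite addn0 !subrr normr0 mulr0.
rewrite addnS /dyadic_sum big_ord_recr/= -!/(dyadic_sum _ _) addrAC.
apply: le_trans (ler_normD _ _) _.
have -> : 2 * B * (2^-1 ^+ N - 2^-1 ^+ (N + j).+1) =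
    2 * B * (2^-1 ^+ N - 2^-1 ^+ (N + j)) + 2^-1 ^+ (N + j) * B.
  by rewrite exprS; field.
apply: lerD => //; rewrite normrM ger0_norm ?exprn_ge0 ?invr_ge0//.
by apply: ler_wpM2l; rewrite ?exprn_ge0 ?invr_ge0.
Qed.

(** The intervals of radius [2 * B * 2^-1 ^+ N] about the partial sums meet pairwise, so the
    supremum of their left ends lies in all of them. *)
Lemma dyadic_sum_lim v B : (forall k, `|v k| <= B) ->
  exists l, forall N, `|l - dyadic_sum v N| <= 2 * B * 2^-1 ^+ N.
Proof.
move=> vB; have B0 : 0 <= B by exact: le_trans (vB 0%N).
have p0 n : 0 <= 2^-1 ^+ n :> R by rewrite exprn_ge0// invr_ge0.
have tail N M : (N <= M)%N -> `|dyadic_sum v M - dyadic_sum v N| <= 2 * B * (2^-1 ^+ N - 2^-1 ^+ M).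
  by move=> NM; rewrite -(subnKC NM); exact: dyadic_sum_tail.
have nested N M : dyadic_sum v N - 2 * B * 2^-1 ^+ N <= dyadic_sum v M + 2 * B * 2^-1 ^+ M.
  have BM : 0 <= 2 * B * 2^-1 ^+ M by rewrite !mulr_ge0.
  have BN : 0 <= 2 * B * 2^-1 ^+ N by rewrite !mulr_ge0.
  have [NM|/ltnW NM] := leqP N M.
    by have := tail _ _ NM; rewrite ler_norml mulrBr => /andP[]; lra.
  by have := tail _ _ NM; rewrite ler_norml mulrBr => /andP[]; lra.
pose E := [set dyadic_sum v N - 2 * B * 2^-1 ^+ N | N in [set: nat]].
exists (sup E) => N; rewrite ler_norml; apply/andP; split.
  rewrite lerBrDr addrC; apply: ub_le_sup; last by exists N.
  by exists (dyadic_sum v N + 2 * B * 2^-1 ^+ N) => _ [M _ <-]; exact: nested.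
rewrite lerBlDr addrC; apply: ge_sup; first by exists (dyadic_sum v 0 - 2 * B * 2^-1 ^+ 0), 0%N.
by move=> _ [M _ <-]; exact: nested.
Qed.

Lemma continuous_dyadic_sum (f : nat -> R -> R) N : (forall k, continuous (f k)) ->
  continuous (fun x => dyadic_sum (f^~ x) N).
Proof.
move=> cf; elim: N => [|N IH].
  rewrite (_ : (fun x => _) = fun=> 0); first by move=> x; exact: cvg_cst.
  by apply/funext => x; rewrite /dyadic_sum big_ord0.
rewrite (_ : (fun x => _) = fun x => dyadic_sum (f^~ x) N + 2^-1 ^+ N * f N x).
  by apply: continuous_add => //; exact: continuous_scale.
by apply/funext => x; rewrite /dyadic_sum big_ord_recr.
Qed.

Lemma antiderivative_dyadic_sum (F f : nat -> R -> R) N :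
  (forall k, antiderivative (F k) (f k)) ->
  antiderivative (fun x => dyadic_sum (F^~ x) N) (fun x => dyadic_sum (f^~ x) N).
Proof. by move=> H; apply: antiderivative_sum => k; exact: antiderivativeZ. Qed.

(** Uniform convergence makes every [F i] continuous. A primitive of [F i.+1] minus the partial sum
    of order [i] has a uniformly small derivative, so by the mean value theorem [F i] differs from
    that primitive by a constant. *)
Lemma dyadic_tower D phi B : (forall k, tower D (phi k)) ->
  (forall k i x, (i <= D)%N -> `|phi k i x| <= B) ->
  exists F, tower D F /\ forall i x N, (i <= D)%N ->
    `|F i x - dyadic_sum (fun k => phi k i x) N| <= 2 * B * 2^-1 ^+ N.
Proof.
move=> tphi phiB.
have /choice[F0 HF0] : forall p : nat * R, exists l : R, (p.1 <= D)%N -> forall N,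
    `|l - dyadic_sum (fun k => phi k p.1 p.2) N| <= 2 * B * 2^-1 ^+ N.
  move=> [i x] /=; have [iD|_] := boolP (i <= D)%N; last by exists 0.
  have [l Hl] := @dyadic_sum_lim (fun k => phi k i x) B (fun k => phiB k i x iD).
  by exists l.
pose F i x := F0 (i, x).
have HF i x N : (i <= D)%N -> `|F i x - dyadic_sum (fun k => phi k i x) N| <= 2 * B * 2^-1 ^+ N.
  by move=> iD; exact: (HF0 (i, x) iD).
have cF i : (i <= D)%N -> continuous (F i).
  move=> iD x; apply/cvgrPdist_lt => e e0.
  have [N HN] := half_pow_small (2 * B) (divr_gt0 e0 (ltr0n _ 3)).
  have {}HN := HN N (leqnn N).
  have cS : continuous (fun x => dyadic_sum (fun k => phi k i x) N).
    by apply: continuous_dyadic_sum => k; exact: tower_continuous (tphi k) iD.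
  near=> z.
  have : `|dyadic_sum (fun k => phi k i x) N - dyadic_sum (fun k => phi k i z) N| < e / 3.
    by near: z; apply: cvgr_dist_lt (cS x) _ _; rewrite divr_gt0.
  have := HF i x N iD; have := HF i z N iD.
  rewrite !ler_norml !ltr_norml => /andP[? ?] /andP[? ?] /andP[? ?].
  by apply/andP; split; lra.
exists F; split => //; split; last exact: cF.
move=> i iD; have iD' := ltnW iD.
have P := prim_antiderivative (cF _ iD).
have E x : F i x - F i 0 = prim (F i.+1) x - prim (F i.+1) 0.
  apply/eqP; rewrite -subr_eq0 -normr_le0.
  apply: (@le_of_dyadic (2 * B * (2 + `|x|)) _ _ 0) => N _; rewrite add0r.
  have Q := antiderivativeB P (antiderivative_dyadic_sum N (fun k => (tphi k).1 i iD)).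
  have Qx : `|(prim (F i.+1) x - dyadic_sum (fun k => phi k i x) N)
      - (prim (F i.+1) 0 - dyadic_sum (fun k => phi k i 0) N)| <= 2 * B * 2^-1 ^+ N * `|x|.
    have [x0|x0|<-] := ltgtP 0 x; last by rewrite subrr normr0 mulr0.
    - have [c _ ->] := antiderivative_mvt Q x0.
      by rewrite subr0 normrM ler_wpM2r//; exact: HF.
    - have [c _] := antiderivative_mvt Q x0; rewrite distrC => ->.
      by rewrite sub0r normrM normrN ler_wpM2r//; exact: HF.
  have := HF i x N iD'; have := HF i 0 N iD'; move: Qx.
  rewrite mulrDr mulrDl [2 * B * `|x| * _]mulrAC.
  move: (2 * B * 2^-1 ^+ N * `|x|) => b.
  have -> : 2 * B * 2 * 2^-1 ^+ N = 2 * (2 * B * 2^-1 ^+ N) by ring.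
  move: (2 * B * 2^-1 ^+ N) => b'.
  rewrite !ler_norml => /andP[? ?] /andP[? ?] /andP[? ?].
  by apply/andP; split; lra.
have := antiderivativeD P (antiderivative_cst (F i 0 - prim (F i.+1) 0)).
by apply: antiderivative_ext => x; [have := E x; lra | rewrite addr0].
Unshelve. all: by end_near. Qed.

Lemma dyadic_lim_ge v B l n : (forall k, 0 <= v k) ->
  (forall N, `|l - dyadic_sum v N| <= 2 * B * 2^-1 ^+ N) -> 2^-1 ^+ n * v n <= l.
Proof.
move=> v0 H; apply: (@le_of_dyadic (2 * B) _ _ n.+1) => N nN.
apply: (@le_trans _ _ (dyadic_sum v N)).
  rewrite /dyadic_sum (bigD1 (Ordinal nN))//= lerDl sumr_ge0// => k _.
  by rewrite mulr_ge0// exprn_ge0// invr_ge0.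
by have := H N; rewrite ler_norml => /andP[]; lra.
Qed.

Lemma dyadic_lim_eq0 v B l : (forall k, v k = 0) ->
  (forall N, `|l - dyadic_sum v N| <= 2 * B * 2^-1 ^+ N) -> l = 0.
Proof.
move=> v0 H; apply/eqP; rewrite -normr_le0.
apply: (@le_of_dyadic (2 * B) _ _ 0) => N _; rewrite add0r.
have := H N; rewrite /dyadic_sum big1 ?subr0// => k _; rewrite v0 mulr0//.
Qed.

Lemma dyadic_lim_norm_le v B l :
  (forall N, `|l - dyadic_sum v N| <= 2 * B * 2^-1 ^+ N) -> `|l| <= 2 * B.
Proof. by move=> /(_ 0%N); rewrite /dyadic_sum big_ord0 subr0 expr0 mulr1. Qed.

End DyadicSeries.

(** * Periodization and periodic antiderivatives *)

Section Periodic.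
Variable R : realType.
Implicit Types (f g : R -> R) (G U : nat -> R -> R) (al de K x z : R) (i k D q : nat).

Let pi2_gt0 : 0 < 2 * pi :> R. Proof. by rewrite mulr_gt0// pi_gt0. Qed.

Definition period_index al x : int := Num.floor ((x - al) / (2 * pi)).

Definition reduce al x : R := x - 2 * pi * (period_index al x)%:~R.

Lemma reduce_itv al x : al <= reduce al x < al + 2 * pi.
Proof.
rewrite /reduce /period_index; have /andP[] := floor_itv ((x - al) / (2 * pi)).
by rewrite ler_pdivlMr// ltr_pdivrMr// intrD mulr1z; lra.
Qed.

Lemma reduce_eq al x (m : int) : al <= x - 2 * pi * m%:~R < al + 2 * pi ->
  reduce al x = x - 2 * pi * m%:~R.
Proof.
move=> xm; rewrite /reduce /period_index (@floor_def _ _ m)//.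
rewrite ler_pdivlMr// ltr_pdivrMr// intrD mulr1z.
by case/andP: xm => ? ?; apply/andP; split; lra.
Qed.

Lemma periodic_int f x (m : int) : periodic2pi f -> f (x - 2 * pi * m%:~R) = f x.
Proof.
move=> pf; have pn z n : f (z + 2 * pi * n%:R) = f z.
  elim: n => [|n IH]; first by rewrite mulr0 addr0.
  by rewrite -[n.+1%:R]natr1 mulrDr mulr1 addrA pf.
case: m => n; first by rewrite -(pn (x - _) n) -pmulrn subrK.
by rewrite NegzE mulrNz mulrN opprK -pmulrn pn.
Qed.

Lemma periodic_reduce f al x : periodic2pi f -> f x = f (reduce al x).
Proof. by move=> pf; rewrite /reduce periodic_int. Qed.

Lemma reduce_add2pi al x : reduce al (x + 2 * pi) = reduce al x.
Proof.
have E : x + 2 * pi - 2 * pi * (period_index al x + 1)%:~R = reduce al x.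
  by rewrite /reduce intrD; ring.
by rewrite -E; apply: reduce_eq; rewrite E; exact: reduce_itv.
Qed.

Lemma tower_periodize D G al de : 0 < de -> tower D G ->
  (forall i x, (i <= D)%N -> x < al + de -> G i x = 0) ->
  (forall i x, (i <= D)%N -> al + 2 * pi - de < x -> G i x = 0) ->
  tower D (fun i x => G i (reduce al x)).
Proof.
move=> de0 tG Gl Gr.
(* Near [x] the periodization is one fixed translate of [G i]. If [z] slips below the seam [al],
   both sides are 0, as [G] vanishes within [de] of either end. *)
have loc i x : (i <= D)%N ->
    \forall z \near x, G i (z - 2 * pi * (period_index al x)%:~R) = G i (reduce al z).
  move=> iD; have /andP[x1 x2] := reduce_itv al x.
  near=> z; pose z' := z - 2 * pi * (period_index al x)%:~R; rewrite -/z'.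
  have E : z' - reduce al x = z - x by rewrite /z' /reduce; ring.
  have d1 : `|x - z| < de by near: z; exact: cvgr_dist_lt.
  have d2 : `|x - z| < al + 2 * pi - reduce al x.
    by near: z; apply: cvgr_dist_lt => //; rewrite subr_gt0.
  have d3 : `|x - z| < 2 * pi by near: z; exact: cvgr_dist_lt.
  move: d1 d2 d3; rewrite !ltr_norml => /andP[? ?] /andP[? ?] /andP[? ?].
  have [zal|zal] := leP al z'.
    have R1 : reduce al z = z' by apply: reduce_eq; rewrite -/z'; lra.
    by rewrite R1.
  rewrite Gl//; last by lra.
  have zE : z - 2 * pi * (period_index al x - 1)%:~R = z' + 2 * pi.
    by rewrite /z' intrB mulr1z; ring.
  rewrite (@reduce_eq al z (period_index al x - 1)) zE; last by apply/andP; split; lra.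
  by rewrite Gr//; lra.
have sub_affine i c : antiderivative (fun z => G i z) (fun z => G i.+1 z) ->
    antiderivative (fun z => G i (z - c)) (fun z => G i.+1 (z - c)).
  move=> /(antiderivative_affine 1 (- c)).
  by apply: antiderivative_ext => z; rewrite !mul1r.
split=> [i iD x|x].
  apply: (near_eq_is_derive (loc i x (ltnW iD))).
  by have := sub_affine i (2 * pi * (period_index al x)%:~R) (tG.1 i iD) x.
have := loc D x (leqnn D) => /near_eq_cvg h.
have c1 : {for x, continuous (fun z => G D (z - 2 * pi * (period_index al x)%:~R))}.
  apply: (@continuous_comp _ _ _ (fun z => z - 2 * pi * (period_index al x)%:~R) (G D)).
    by apply: cvgB; [exact: cvg_id | exact: cvg_cst].
  exact: tG.2.
exact: cvg_trans h c1.
Unshelve. all: by end_near. Qed.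

(** Mean value zero of [g] makes its primitive periodic, and subtracting the mean of the primitive
    lets the step be repeated. The bound holds as [F x] is the mean over [t] of the increments of
    the primitive from [t] to the reduced [x]. *)
Lemma periodic_antiderivative g al K : continuous g -> periodic2pi g ->
  itg al (al + 2 * pi) g = 0 -> (forall x, `|g x| <= K) ->
  exists F, [/\ antiderivative F g, periodic2pi F, itg al (al + 2 * pi) F = 0 &
    forall x, `|F x| <= 2 * pi * K].
Proof.
move=> cg pg g0 gK; have P := prim_antiderivative cg.
have cP := antiderivative_continuous P.
have pP : periodic2pi (prim g).
  move=> x; have H := antiderivativeB (antiderivative_affine 1 (2 * pi) P) P.
  have {}H : antiderivative (fun x => prim g (x + 2 * pi) - prim g x) (fun=> 0).
    by apply: antiderivative_ext H => z; rewrite ?mul1r// pg subrr.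
  have := antiderivative0_cst x al H; move: g0; rewrite /itg => ->.
  by move/eqP; rewrite subr_eq0 => /eqP.
pose mu := itg al (al + 2 * pi) (prim g) / (2 * pi).
have pi20 : 2 * pi != 0 :> R by rewrite gt_eqF.
have cc (c : R) : continuous (fun _ : R => c) by move=> x; exact: cvg_cst.
exists (fun x => prim g x - mu); split.
- by apply: antiderivative_ext (antiderivativeB P (antiderivative_cst mu)) => x //; rewrite subr0.
- by move=> x; rewrite pP.
- by rewrite itgB// itg_cst /mu [al + _]addrC addrK divfK// subrr.
- move=> x; rewrite (periodic_reduce al x pP); set x' := reduce al x.
  have /andP[x1 x2] : al <= x' < al + 2 * pi by exact: reduce_itv.
  have -> : prim g x' - mu = itg al (al + 2 * pi) (fun t => prim g x' - prim g t) / (2 * pi).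
    by rewrite itgB// itg_cst [al + _]addrC addrK mulrBl mulfK// addrC.
  rewrite normrM [`|_^-1|]gtr0_norm ?invr_gt0// ler_pdivrMr//.
  have -> : 2 * pi * K * (2 * pi) = 2 * pi * K * (al + 2 * pi - al) by ring.
  apply: norm_itg_le => [||t /andP[t1 t2]]; first by rewrite lerDl ltW.
    exact: continuous_sub.
  have K0 : 0 <= K by exact: le_trans (gK 0).
  have lip u v : u < v -> al <= u -> v <= al + 2 * pi -> `|prim g v - prim g u| <= 2 * pi * K.
    move=> uv alu val; have [c _ ->] := antiderivative_mvt P uv.
    by rewrite normrM mulrC ler_pM// gtr0_norm ?subr_gt0//; lra.
  have [tx|xt|->] := ltgtP t x'; last by rewrite subrr normr0 !mulr_ge0// pi_ge0.
  - by apply: lip => //; exact: ltW.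
  - by rewrite distrC; exact: lip.
Qed.

(** Places [q] periodic antiderivatives beneath [G], which turns a prescribed [q]-th derivative into
    a function. *)
Lemma periodic_tower q D G al K : tower D G -> periodic2pi (G 0%N) ->
  itg al (al + 2 * pi) (G 0%N) = 0 -> (forall x, `|G 0%N x| <= K) ->
  exists U, [/\ tower (q + D) U, forall i, U (q + i)%N = G i, periodic2pi (U 0%N),
    itg al (al + 2 * pi) (U 0%N) = 0 & forall x, `|U 0%N x| <= (2 * pi) ^+ q * K].
Proof.
move=> tG pG G0 GK; elim: q => [|q [U [tU UG pU U0 UK]]].
  by exists G; split=> // x; rewrite expr0 mul1r.
have [F [FU pF F0 FK]] := periodic_antiderivative (tower_continuous tU (leq0n _)) pU U0 UK.
exists (fun i => if i is j.+1 then U j else F); split => //.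
- split=> [[|i] //= iq|]; first exact: tU.1.
  exact: tU.2.
- by move=> x; rewrite exprS -mulrA.
Qed.

End Periodic.

(** * Rescaled and translated bumps *)

Section PlacedBump.
Variable R : realType.
Implicit Types (ka a h u v x : R) (i D : nat).

(** The [i]-th derivative of [ka * bump D 0 ((x - a) / h)], supported between [a + h / 2] and
    [a + h]. *)
Definition placed_bump D ka a h i x : R :=
  ka * (h^-1 ^+ i * bump D i (h^-1 * x + - (a / h))).

Lemma tower_placed_bump D ka a h : tower D (placed_bump D ka a h).
Proof. exact: (towerZ ka (tower_affine h^-1 (- (a / h)) (tower_bump R D))). Qed.

Lemma placed_bump_eq0 D ka a h i x : 0 < h -> (i <= D)%N ->
  ~~ (a + h / 2 < x < a + h) -> placed_bump D ka a h i x = 0.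
Proof.
move=> h0 iD xn; rewrite /placed_bump bump_eq0 ?mulr0//; apply: contra xn.
have -> : h^-1 * x + - (a / h) = (x - a) / h by rewrite mulrBl mulrC.
by rewrite ltr_pdivlMr// ltr_pdivrMr// => /andP[? ?]; apply/andP; split; lra.
Qed.

Lemma placed_bump_ge0 D ka a h x : 0 <= ka -> 0 <= placed_bump D ka a h 0 x.
Proof. by move=> ka0; rewrite /placed_bump expr0 mul1r mulr_ge0// bump_ge0. Qed.

Lemma itg_placed_bump D ka a h u v : 0 < h -> u <= a -> a + h <= v ->
  itg u v (placed_bump D ka a h 0) = ka * h * itg 0 1 (bump D 0).
Proof.
move=> h0 ua av; have cb := tower_continuous (tower_bump R D) (leq0n D).
have out u' v' : u' <= v' -> (forall x, u' <= x <= v' -> ~~ (2^-1 < x < 1)) -> itg u' v' (bump D 0) = 0.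
  move=> uv H; rewrite -[RHS](mul0r (v' - u')) -itg_cst; apply: itg_eq_in => //.
    by move=> x; exact: cvg_cst.
  by move=> x /H; exact: bump_eq0.
have E : h^-1 != 0 by rewrite invr_eq0 gt_eqF.
rewrite (@eq_itg _ _ (fun x => ka * bump D 0 (h^-1 * x + - (a / h)))); last first.
  by move=> x; rewrite /placed_bump expr0 mul1r.
have cba : continuous (fun x => bump D 0 (h^-1 * x + - (a / h))).
  have := tower_continuous (tower_affine h^-1 (- (a / h)) (tower_bump R D)) (leq0n D).
  by under eq_fun do rewrite expr0 mul1r.
rewrite itgZ//.
rewrite itg_affine// invrK.
have -> : h^-1 * u + - (a / h) = (u - a) / h by rewrite mulrBl mulrC.
have -> : h^-1 * v + - (a / h) = (v - a) / h by rewrite mulrBl mulrC.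
have u0 : (u - a) / h <= 0 by rewrite ler_pdivrMr//; lra.
have v1 : 1 <= (v - a) / h by rewrite ler_pdivlMr//; lra.
rewrite (itg_cat 0) (@itg_cat _ 1 _ 0) out//; last first.
  by move=> x /andP[_ x0]; apply/negP => /andP[]; lra.
rewrite [itg 1 _ _]out//; last first.
  by move=> x /andP[x0 _]; apply/negP => /andP[]; lra.
by rewrite add0r addr0 mulrA.
Qed.

Lemma placed_bump_le D ka a h i x B : 0 <= ka -> 0 < h ->
  (forall t, `|bump D i t| <= B) -> `|placed_bump D ka a h i x| <= ka * h^-1 ^+ i * B.
Proof.
move=> ka0 h0 HB; have k0 : 0 <= ka * h^-1 ^+ i by rewrite mulr_ge0// exprn_ge0// invr_ge0 ltW.
by rewrite /placed_bump mulrA normrM ger0_norm// ler_wpM2l.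
Qed.

End PlacedBump.

(** * Infinitely many bumps accumulating at a point *)

Section BumpTrain.
Variable R : realType.
Implicit Types (a h r x : R) (i k D : nat).

(** [H k r] is an arbitrary rule giving the width of the [k]-th bump inside a window of radius [r].
    Within window [k], earlier bumps are too far out to be seen and later ones lie inside
    [[a, a + h k]], so the sum looks concentrated at scale [h k]. *)
Lemma bump_train D a r0 (H : nat -> R -> R) B : 0 < r0 <= 1 ->
  (forall k r, 0 < r <= r0 -> 0 < H k r <= r) ->
  (forall i t, (i <= D)%N -> `|bump D i t| <= B) ->
  exists (r : nat -> R) (F : nat -> R -> R), 
   [/\ tower D F, forall x, 0 <= F 0%N x, forall i x, (i <= D)%N -> `|F i x| <= 2 * B,
     forall i x, (i <= D)%N -> ~~ (a < x < a + r0) -> F i x = 0 &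
     forall k, [/\ 0 < r k <= r0,
       forall x, a - r k <= x <= a + r k -> ~~ (a <= x <= a + H k (r k)) -> F 0%N x = 0 &
       2^-1 ^+ k * itg 0 1 (bump D 0) * H k (r k) ^+ D.+1 <= itg (a - r k) (a + r k) (F 0%N)]].
Proof.
move=> /andP[r00 r01] HH HB.
(* The next window ends where the support of the current bump begins. *)
pose r := fix r k := if k is j.+1 then H j (r j) / 2 else r0.
have rP k : 0 < r k <= r0.
  elim: k => [|k IH] /=; first by rewrite r00 lexx.
  by have /andP[h0 hr] := HH k (r k) IH; case/andP: IH; lra.
pose h k := H k (r k).
have hP k : 0 < h k <= r k by exact: HH.
have h0 k : 0 < h k by case/andP: (hP k).
have rS k : r k.+1 = h k / 2 by [].
have hlt j k : (j < k)%N -> h k <= h j / 2 /\ r k <= h j / 2.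
  elim: k => [//|k IH]; rewrite ltnS leq_eqVlt => /predU1P[->|jk].
    by have := hP k.+1; rewrite rS => /andP[_ ?]; split.
  have [IH1 IH2] := IH jk; have := hP k.+1; rewrite rS => /andP[_ ?].
  by have := h0 k; split; lra.
(* The height [h ^ D] is the largest order keeping all derivatives up to [D] bounded uniformly in
   [k]; the mass is then of order [h ^ (D + 1)]. *)
pose phi k := placed_bump D (h k ^+ D) a (h k).
have tphi k : tower D (phi k) by exact: tower_placed_bump.
have h1 k : h k <= 1 by have := hP k; have := rP k => /andP[_ ?] /andP[_ ?]; lra.
have phiB k i x : (i <= D)%N -> `|phi k i x| <= B.
  move=> iD; apply: le_trans (placed_bump_le a x _ (h0 k) (fun t => HB i t iD)) _.
    by rewrite exprn_ge0// ltW.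
  have B0 : 0 <= B by exact: le_trans (HB i 0 iD).
  rewrite -[leRHS]mul1r ler_wpM2r// -(subnK iD) exprD -mulrA exprVn mulfV ?mulr1.
    by rewrite exprn_ile1// ltW.
  by rewrite expf_neq0// gt_eqF.
have [F [tF HF]] := dyadic_tower tphi phiB.
have phi0 k x : 0 <= phi k 0%N x by apply: placed_bump_ge0; rewrite exprn_ge0// ltW.
have phiE k i x : (i <= D)%N -> ~~ (a + h k / 2 < x < a + h k) -> phi k i x = 0.
  by move=> iD; exact: placed_bump_eq0.
have F0 x : 0 <= F 0%N x.
  apply: le_trans (dyadic_lim_ge 0 (fun k => phi0 k x) (fun N => HF 0%N x N (leq0n D))).
  by rewrite expr0 mul1r.
exists r, F; split => //.
- by move=> i x iD; apply: dyadic_lim_norm_le (fun N => HF i x N iD).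
- move=> i x iD xn; apply: (dyadic_lim_eq0 _ (fun N => HF i x N iD)) => k.
  apply: phiE => //; apply: contra xn => /andP[x1 x2].
  have := h0 k; have := hP k; have := rP k => /andP[_ ?] /andP[_ ?] ?.
  by apply/andP; split; lra.
move=> k; split => //.
  move=> x xr xn; apply: (dyadic_lim_eq0 _ (fun N => HF 0%N x N (leq0n D))) => j.
  apply: phiE => //; apply: contra xn => /andP[x1 x2]; have hj := h0 j.
  have [jk|kj] := ltnP j k.
    by have [_ ?] := hlt _ _ jk; case/andP: xr => ? ?; exfalso; lra.
  move: kj; rewrite leq_eqVlt => /predU1P[->|kj]; rewrite -/(h _).
    by apply/andP; split; lra.
  by have [? _] := hlt _ _ kj; apply/andP; split; lra.
rewrite -/(h k); have /andP[hk0 hkr] := hP k.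
have -> : 2^-1 ^+ k * itg 0 1 (bump D 0) * h k ^+ D.+1 =
    itg (a - r k) (a + r k) (fun x => 2^-1 ^+ k * phi k 0%N x).
  rewrite itgZ; last exact: tower_continuous (tphi k) _.
  rewrite itg_placed_bump//; [by rewrite exprSr; ring|lra|lra].
apply: le_itg => //; [lra| |exact: tower_continuous tF _|].
  by apply: continuous_scale; exact: tower_continuous (tphi k) _.
by move=> x _; exact: dyadic_lim_ge (fun k => phi0 k x) (fun N => HF 0%N x N (leq0n D)).
Qed.

End BumpTrain.

(** * Balancing the bump train to mean zero and integrating it [q] times *)

Theorem theorem1p6 (R : realType) (q p s : nat) (y : nat -> R)
  (hq : (3 <= q)%N) (hpq : (q <= p)%N) (hs : (0 < s)%N)
  (hy_dec : forall i : nat, (1 <= i < 2 * s)%N -> y i.+1 < y i)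
  (hy_per : y 1%N < y (2 * s)%N + 2 * pi)
  (eps : nat -> R) (heps_pos : forall n : nat, (0 < n)%N -> 0 < eps n)
  (heps_inf : eps n @[n --> \oo] --> +oo) :
  exists f : R -> R, Delta q s y f /\ Wr p f /\
    forall (M : R) (N : nat), exists n : nat, (N <= n)%N /\ (0 < n)%N /\
      M < eps n * n%:R ^+ (p - q + 2) * En q s y n f.
Proof.
have q2 : (2 <= q)%N by exact: ltnW.
rewrite -(subnKC hpq) addKn; set D := (p - q)%N.
have yle i j : (1 <= i)%N -> (i <= j <= 2 * s)%N -> y j <= y i.
  move=> i1 /andP[ij]; rewrite -(subnKC ij); elim: (j - i)%N => [|n IH] js; first by rewrite addn0.
  apply: le_trans (IH _); last by rewrite (leq_trans _ js)// addnS.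
  by rewrite addnS ltW// hy_dec// (leq_trans i1 (leq_addr _ _))/= -addnS.
have s2 : (2 <= 2 * s)%N by rewrite leq_pmulr.
set a := y 1%N in hy_per *; pose b := y 2%N; pose y0 := y (2 * s)%N + 2 * pi.
have ba : b < a by apply: hy_dec; rewrite s2.
have y0b : y0 <= b + 2 * pi by rewrite lerD2r; apply: yle; rewrite // s2 leqnn.
have ay0 : a < y0 by [].
pose w := (a - b) / 2.
have w0 : 0 < w by rewrite divr_gt0// subr_gt0.
have bw : b + w = a - w by rewrite /w; lra.
(* The window about [a] covers at most half of the arc to the right and stays clear on the left of
   the compensating bump, which ends at [a - w]. *)
pose r0 := Num.min 1 (Num.min ((y0 - a) / 2) w).
have r00 : 0 < r0 by rewrite !lt_min ltr01 w0 divr_gt0// subr_gt0.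
have r01 : r0 <= 1 by rewrite ge_min lexx.
have r0y : r0 <= (y0 - a) / 2 by rewrite !ge_min lexx !orbT.
have r0w : r0 <= w by rewrite !ge_min lexx !orbT.
have pi0 := @pi_gt0 R.
have [Bb Bb0 HBb] := bump_bounded R D.
have c0 := itg_bump_gt0 R D; set c := itg 0 1 (bump D 0) in c0 *.
(* Normalized to integral 1. *)
pose gam := placed_bump D (w * c)^-1 b w.
have wc0 : 0 < (w * c)^-1 by rewrite invr_gt0 mulr_gt0.
(* Replacing [w^-1] by [1 + w^-1], which is at least 1, bounds all powers [w^-i] with [i <= D] at
   once. *)
pose Kg := (w * c)^-1 * (1 + w^-1) ^+ D * Bb.
have w1 : 1 <= 1 + w^-1 by rewrite lerDl invr_ge0 ltW.
have Kg0 : 0 < Kg by rewrite !mulr_gt0// exprn_gt0// (lt_le_trans ltr01).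
have gamB i x : (i <= D)%N -> `|gam i x| <= Kg.
  move=> iD; apply: le_trans (placed_bump_le b x (ltW wc0) w0 (fun t => HBb i t iD)) _.
  apply: ler_wpM2r; first exact: ltW.
  apply: ler_wpM2l; first exact: ltW.
  apply: (@le_trans _ _ ((1 + w^-1) ^+ i)); last by rewrite ler_weXn2l.
  by rewrite lerXn2r ?nnegrE ?invr_ge0 ?addr_ge0 ?invr_ge0 ?(ltW w0)// lerDr.
have gamE i x : (i <= D)%N -> ~~ (b + w / 2 < x < a - w) -> gam i x = 0.
  by move=> iD; rewrite -bw; exact: placed_bump_eq0.
(* Scales [F i - m * gam i] to norm at most 2, given [|F i| <= 2 Bb], [m <= 2 Bb * 2 pi] and
   [|gam i| <= Kg]. *)
pose la := 2 / (2 * Bb + 2 * Bb * (2 * pi) * Kg).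
have den0 : 0 < 2 * Bb + 2 * Bb * (2 * pi) * Kg by apply: addr_gt0; do 4?[apply: mulr_gt0 => //].
have la0 : 0 < la by rewrite divr_gt0.
have pB0 : 0 <= (2 * pi) ^+ q * 2 :> R by rewrite mulr_ge0// exprn_ge0// mulr_ge0// ltW.
have mu0 k : 0 < la * (2^-1 ^+ k * c) by rewrite mulr_gt0// mulr_gt0// exprn_gt0// invr_gt0.
(* Width and degree are selected for every stage and radius in advance. The mass constant includes
   [la] and the damping [2^-k], and the bound on [U 0] is the one [periodic_tower] will supply. *)
have /choice[HN HHN] : forall kr : nat * R, exists hn : R * nat, 0 < kr.2 <= r0 ->
   [/\ 0 < hn.1 <= kr.2, (kr.1 <= hn.2)%N, (0 < hn.2)%N &
    forall U, tower q U ->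
      (forall x, a - kr.2 <= x <= a + kr.2 -> 0 <= U q x) ->
      (forall x, a - kr.2 <= x <= a + kr.2 -> ~~ (a <= x <= a + hn.1) -> U q x = 0) ->
      la * (2^-1 ^+ kr.1 * c) * hn.1 ^+ D.+1 <= itg (a - kr.2) (a + kr.2) (U q) ->
      (forall x, `|U 0%N x| <= (2 * pi) ^+ q * 2) ->
      kr.1%:R < eps hn.2 * hn.2%:R ^+ (D + 2) * En q s y hn.2 (U 0%N)].
  move=> [k r] /=; have [rr|_] := boolP (0 < r <= r0); last by exists (0, 0%N).
  have /andP[r1 r2] := rr.
  have r3 : 0 < r <= 1 by rewrite r1 (le_trans r2).
  have r4 : r < y (2 * s)%N + 2 * pi - y 1%N by rewrite -/a -/y0; lra.
  have r5 : r < y 1%N - y 2%N by rewrite -/a -/b; rewrite /w in r0w w0; lra.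
  have [h [n Hn]] := @En_concentrated_gt R q s D y eps k r _ _ q2 hs heps_inf r3 r4 r5 (mu0 k) pB0.
  by exists (h, n).
pose H k r := (HN (k, r)).1.
have HH k r : 0 < r <= r0 -> 0 < H k r <= r by move=> rr; have [] := HHN (k, r) rr.
have r001 : 0 < r0 <= 1 by rewrite r00.
have [r [F [tF F0 FB FE HF]]] := @bump_train R D a r0 H Bb r001 HH HBb.
pose m := itg b (b + 2 * pi) (F 0%N).
have cF := tower_continuous tF (leq0n D).
have b2pi : b <= b + 2 * pi by rewrite lerDl mulr_ge0// ltW.
have m0 : 0 <= m by apply: itg_ge0.
have m1 : m <= 2 * Bb * (2 * pi).
  apply: le_trans (ler_norm _) _.
  have -> : 2 * Bb * (2 * pi) = 2 * Bb * (b + 2 * pi - b) by ring.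
  by apply: norm_itg_le => // x _; exact: FB.
pose G i x := la * (F i x - m * gam i x).
have tgam : tower D gam by exact: tower_placed_bump.
have tG : tower D G by exact: (towerZ la (towerB tF (towerZ m tgam))).
have GB i x : (i <= D)%N -> `|G i x| <= 2.
  move=> iD; rewrite normrM gtr0_norm// /la mulrAC ler_pdivrMr// ler_pM2l//.
  apply: le_trans (ler_normB _ _) _; apply: lerD; first exact: FB.
  by rewrite normrM ger0_norm// ler_pM// gamB.
(* Periods are cut at [b]; this is a margin on both sides of the cut where neither the train nor the
   compensator lives. *)
pose de := Num.min (w / 2) ((y0 - a) / 2).
have de0 : 0 < de by rewrite lt_min !divr_gt0// subr_gt0.
have dew : de <= w / 2 by rewrite ge_min lexx.
have dey : de <= (y0 - a) / 2 by rewrite ge_min lexx orbT.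
have Gl i x : (i <= D)%N -> x < b + de -> G i x = 0.
  move=> iD xb; rewrite /G FE ?gamE ?mulr0 ?subrr ?mulr0//; apply/negP => /andP[]; clear - w0 bw r00 r0y r0w ba y0b ay0 pi0 dew dey de0 xb; lra.
have Gr i x : (i <= D)%N -> b + 2 * pi - de < x -> G i x = 0.
  move=> iD xb; rewrite /G FE ?gamE ?mulr0 ?subrr ?mulr0//; apply/negP => /andP[]; clear - w0 bw r00 r0y r0w ba y0b ay0 pi0 dew dey de0 xb; lra.
pose P i x := G i (reduce b x).
have tP : tower D P by exact: tower_periodize de0 tG Gl Gr.
have pP i : periodic2pi (P i) by move=> x; rewrite /P reduce_add2pi.
have red x : b <= x < b + 2 * pi -> reduce b x = x.
  by move=> xb; rewrite (@reduce_eq _ b x 0) mulr0z mulr0 subr0.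
have PG x : b <= x <= b + 2 * pi -> P 0%N x = G 0%N x.
  move=> /andP[x1]; rewrite le_eqVlt => /predU1P[->|x2]; last by rewrite /P red ?x1.
  have -> : P 0%N (b + 2 * pi) = P 0%N b by exact: pP.
  rewrite /P red ?lexx ?ltrDl ?mulr_gt0// Gl ?Gr//; clear - w0 bw r00 r0y r0w ba y0b ay0 pi0 dew dey de0; lra.
have P0 : itg b (b + 2 * pi) (P 0%N) = 0.
  rewrite (itg_eq_in b2pi (tower_continuous tP (leq0n D)) (tower_continuous tG (leq0n D)) PG).
  have cg := tower_continuous tgam (leq0n D).
  rewrite /G itgZ; last by apply: continuous_sub => //; exact: continuous_scale.
  rewrite itgB//; last exact: continuous_scale.
  rewrite itgZ// itg_placed_bump//; last by lra.
  by rewrite -/c -mulrA mulVf ?mulr1 ?subrr ?mulr0// gt_eqF// mulr_gt0.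
have PB i x : (i <= D)%N -> `|P i x| <= 2 by move=> iD; exact: GB.
have [U [tU UP pU _ UB]] := periodic_tower q tP (pP 0%N) P0 (fun x => PB 0%N x (leq0n D)).
have Uq : U q = P 0%N by rewrite -[q in LHS]addn0 UP.
have tUq : tower q U by apply: tower_le tU; exact: leq_addr.
exists (U 0%N); split; [|split].
- apply: tower_Delta => // i x /andP[i1 i2]; rewrite Uq.
  case: i i1 i2 => [//|[|[|i]]] _ i2; rewrite /yext/= -/a -/b => /andP[x1 x2].
  + rewrite expr0 mul1r PG; last by apply/andP; split; rewrite -/y0 in x2; clear - w0 bw r00 r0y r0w ba y0b ay0 pi0 dew dey de0 x1 x2; lra.
    rewrite /G gamE// ?mulr0 ?subr0; first by rewrite mulr_ge0// ltW.
    by apply/negP => /andP[]; clear - w0 bw r00 r0y r0w ba y0b ay0 pi0 dew dey de0 x1 x2; lra.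
  + rewrite expr1 mulN1r oppr_ge0 PG; last by apply/andP; split; clear - w0 bw r00 r0y r0w ba y0b ay0 pi0 dew dey de0 x1 x2; lra.
    rewrite /G FE// ?sub0r; last by apply/negP => /andP[]; clear - w0 bw r00 r0y r0w ba y0b ay0 pi0 dew dey de0 x1 x2; lra.
    rewrite mulrN oppr_le0 mulr_ge0// ?(ltW la0)// mulr_ge0//.
    by apply: placed_bump_ge0; exact: ltW.
  (* The remaining arcs, shifted by one period, lie between [y0] and [b + 2 pi], where [G] vanishes;
     either sign is then satisfied. *)
  + have yi : y (2 * s)%N <= y i.+3 by apply: yle; rewrite // i2 leqnn.
    have yb : y i.+2 <= b by apply: yle; rewrite //= (ltnW i2).
    rewrite subSS subn0 /= in x2.
    have xE : x - 2 * pi * (-1)%:~R = x + 2 * pi by rewrite mulrN1z mulrN opprK mulr1.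
    rewrite /P (@reduce_eq _ b x (-1)) xE; last by rewrite /y0 in y0b ay0; apply/andP; split; clear - w0 bw r00 r0y r0w ba y0b ay0 pi0 dew dey de0 x1 x2 yi yb; lra.
    rewrite /G FE// ?gamE// ?mulr0 ?subrr ?mulr0//; apply/negP => /andP[]; rewrite /y0 in r0y ay0; clear - w0 bw r00 r0y r0w ba y0b ay0 pi0 x1 x2 yi yb; lra.
- apply: (tower_Wr _ tU) => //; first by rewrite (leq_trans _ (leq_addr _ _))// (leq_trans _ q2).
  by move=> x; rewrite UP; exact: PB.
(* One stage serves both demands: its degree is at least [k >= N], and its weighted error exceeds
   [k > M]. *)
move=> M N; pose k := maxn N (Num.Def.truncn `|M|).+1.
have Mk : M < k%:R.
  apply: le_lt_trans (ler_norm _) _; apply: lt_le_trans (truncnS_gt _) _.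
  by rewrite ler_nat leq_maxr.
have [rk FE0 Fmass] := HF k.
have [_ kn n0 /(_ U tUq)] := HHN (k, r k) rk.
rewrite /= -/(H k (r k)) Uq => En_gt.
have /andP[rk0 rkr] := rk.
have PF x : a - r k <= x <= a + r k -> P 0%N x = la * F 0%N x.
  move=> /andP[x1 x2]; rewrite PG; last by apply/andP; split; clear - w0 bw r00 r0y r0w ba y0b ay0 pi0 dew dey de0 rk0 rkr x1 x2; lra.
  by rewrite /G gamE ?mulr0 ?subr0//; apply/negP => /andP[]; clear - w0 bw r00 r0y r0w ba y0b ay0 pi0 dew dey de0 rk0 rkr x1 x2; lra.
exists (HN (k, r k)).2; split; first by rewrite (leq_trans _ kn)// leq_maxl.
split => //; apply: (lt_trans Mk); apply: En_gt => //.
- by move=> x xr; rewrite PF// mulr_ge0// ltW.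
- by move=> x xr xn; rewrite PF// FE0// mulr0.
- rewrite -mulrA.
  apply: le_trans (ler_wpM2l (ltW la0) Fmass) _.
  rewrite -itgZ// le_eqVlt; apply/orP; left; apply/eqP; apply: itg_eq_in.
  + by clear - rk0; lra.
  + exact: continuous_scale.
  + exact: tower_continuous tP _.
  + by move=> x xr; rewrite PF.
Qed.
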